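(* A Banach lattice $E$ has the positive Schur property if and only if every absolutely weakly compact subset of $E$ is contained in the closed convex hull of an absolutely weakly null sequence in $E$.
   Context: Banach lattices are real; $E^*$ denotes the topological dual of $E$. The absolute weak topology $|\sigma|(E,E^* )$ on a Banach lattice $E$ is the locally convex-solid topology generated by the lattice seminorms $p_{x^*}(x) = |x^*|(|x|)$, $x \in E$, where $x^*$ ranges over $E^*$. A subset of $E$ is absolutely weakly compact if it is compact for $|\sigma|(E,E^* )$. A sequence in $E$ is absolutely weakly null if it converges to $0$ in $|\sigma|(E,E^* )$. The closed convex hull $\overline{\mathrm{co}}(A)$ of a set $A$ is the norm closure of its convex hull; the closed convex hull of a sequence is that of the set of its terms. A Banach lattice $E$ has the positive Schur property if every weakly null sequence of positive elements of $E$ is norm null. *)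

(* Defs.v *)
From HB Require Import structures.
From mathcomp Require Import all_boot all_order all_algebra.
From mathcomp Require Import all_classical all_reals all_analysis.

Set Implicit Arguments.
Unset Strict Implicit.
Unset Printing Implicit Defensive.

Import Order.TTheory GRing.Theory Num.Theory.
Import numFieldNormedType.Exports.

Local Open Scope classical_set_scope.
Local Open Scope ring_scope.

(* The order is a field of the mixin because Hierarchy-Builder cannot join the
   classes of [order] with normed modules: [numDomainType], declared earlier,
   already inherits from both. *)
HB.mixin Record isBanachLattice (R : realType) E
    & CompleteNormedModule R E := {
  vle : rel E;
  vjoin : E -> E -> E;
  vmeet : E -> E -> E;
  vle_refl : reflexive vle;
  vle_anti : antisymmetric vle;
  vle_trans : transitive vle;
  vleUx : forall x y z, vle (vjoin x y) z = vle x z && vle y z;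
  vlexI : forall x y z, vle x (vmeet y z) = vle x y && vle x z;
  vleD2r : forall z x y : E, vle x y -> vle (x + z) (y + z);
  vscale_ge0 : forall (a : R) (x : E), 0 <= a -> vle 0 x -> vle 0 (a *: x);
  ler_vnorm : forall x y : E,
    vle (vjoin x (- x)) (vjoin y (- y)) -> `|x| <= `|y|
}.

#[short(type="banachLatticeType")]
HB.structure Definition BanachLattice (R : realType) :=
  {E of isBanachLattice R E & CompleteNormedModule R E}.

Arguments vle_trans {R s} [_ _ _].

Definition vabs (R : realType) (E : banachLatticeType R) (x : E) : E :=
  vjoin x (- x).

Record dual (R : realType) (E : banachLatticeType R) := Dual {
  dual_fun :> {linear E -> R^o};
  dual_continuous : continuous dual_fun
}.

Definition dual_le (R : realType) (E : banachLatticeType R)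
    (f g : E -> R) : Prop :=
  forall x : E, vle 0 x -> f x <= g x.

(* g is the supremum of f and - f in the dual. *)
Definition is_dual_abs (R : realType) (E : banachLatticeType R)
    (f g : dual E) : Prop :=
  [/\ dual_le f g, dual_le (- (f : E -> R)) g &
      forall h : dual E,
        dual_le f h -> dual_le (- (f : E -> R)) h -> dual_le g h].

Section dual_abs_existence.
Context (R : realType) (E : banachLatticeType R).
Implicit Types x y z : E.

Let leUl x y : vle x (vjoin x y).
Proof. by have := vle_refl (vjoin x y); rewrite vleUx => /andP[]. Qed.

Let leUr x y : vle y (vjoin x y).
Proof. by have := vle_refl (vjoin x y); rewrite vleUx => /andP[]. Qed.

Let leIl x y : vle (vmeet x y) x.
Proof. by have := vle_refl (vmeet x y); rewrite vlexI => /andP[]. Qed.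

Let leIr x y : vle (vmeet x y) y.
Proof. by have := vle_refl (vmeet x y); rewrite vlexI => /andP[]. Qed.

Let leU x y z : vle x z -> vle y z -> vle (vjoin x y) z.
Proof. by rewrite vleUx => -> ->. Qed.

Let leI x y z : vle x y -> vle x z -> vle x (vmeet y z).
Proof. by rewrite vlexI => -> ->. Qed.

Let leDr z x y : vle (x + z) (y + z) = vle x y.
Proof.
by apply/idP/idP => [/(vleD2r (- z))|/vleD2r]; rewrite ?addrK.
Qed.

Let leBDr x y z : vle (x - y) z = vle x (z + y).
Proof. by rewrite -(leDr y) subrK. Qed.

Let leDBr x y z : vle x (z - y) = vle (x + y) z.
Proof. by rewrite -(leDr y) subrK. Qed.

Let leN x y : vle (- x) (- y) = vle y x.
Proof. by rewrite -(leDr (x + y)) addKr addrC addrK. Qed.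

Let leD x y z t : vle x y -> vle z t -> vle (x + z) (y + t).
Proof.
move=> xy zt; apply: (@vle_trans _ _ (y + z)); first exact: vleD2r.
by rewrite ![y + _]addrC leDr.
Qed.

Let vabs_le x y : vle (vabs x) y = vle x y && vle (- x) y.
Proof. exact: vleUx. Qed.

Let vabs_ge0 x : vle 0 (vabs x).
Proof.
have h : vle 0 (vabs x + vabs x).
  by rewrite -(subrr x); apply: leD; [exact: leUl|exact: leUr].
have half0 : 0 <= 2^-1 :> R by rewrite invr_ge0.
have := vscale_ge0 _ _ half0 h.
by rewrite -(mulr2n (vabs x)) -[vabs x *+ 2]scaler_nat scalerA mulVf ?pnatr_eq0// scale1r.
Qed.

Let vabs_ger0 x : vle 0 x -> vabs x = x.
Proof.
move=> x0; apply: vle_anti; rewrite leUl andbT; apply: leU; first exact: vle_refl.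
by apply: (vle_trans _ x0); rewrite -[X in vle _ X]oppr0 leN.
Qed.

Let ler_norm_abs x y : vle (vabs x) y -> `|x| <= `|y|.
Proof. by move=> xy; apply: ler_vnorm; apply: (vle_trans xy); exact: leUl. Qed.

Let pos x := vjoin x 0.

Let pos_ge0 x : vle 0 (pos x). Proof. exact: leUr. Qed.

Let posE x : pos x - pos (- x) = x.
Proof.
apply/eqP; rewrite subr_eq addrC; apply/eqP; apply: vle_anti.
apply/andP; split.
- by apply: leU; rewrite -leBDr ?subrr ?sub0r ?leUr ?leUl.
- by rewrite -leDBr; apply: leU; rewrite leDBr ?addNr ?add0r ?leUl ?leUr.
Qed.

Let pos_abs x : vle (pos x + pos (- x)) (vabs x).
Proof.
rewrite -leDBr; apply: leU; rewrite leDBr.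
- rewrite addrC -leDBr; apply: leU; rewrite leDBr ?addNr ?vabs_ge0//.
  by rewrite add0r leUl.
- by rewrite add0r; apply: leU; [exact: leUr|exact: vabs_ge0].
Qed.

Let riesz_decomposition x z y : vle 0 x -> vle 0 z -> vle (vabs y) (x + z) ->
  exists y1 y2, [/\ y = y1 + y2, vle (vabs y1) x & vle (vabs y2) z].
Proof.
move=> x0 z0; rewrite vabs_le => /andP[yxz Nyxz].
have Nx0 : vle (- x) 0 by rewrite -[X in vle _ X]oppr0 leN.
have Nz0 : vle (- z) 0 by rewrite -[X in vle _ X]oppr0 leN.
pose y1 := vjoin (vmeet y x) (- x).
exists y1, (y - y1); split; first by rewrite addrC subrK.
- rewrite vabs_le; apply/andP; split.
    by apply: leU; [exact: leIr|exact: vle_trans Nx0 x0].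
  by rewrite -[X in vle _ X]opprK leN leUr.
rewrite vabs_le; apply/andP; split.
- rewrite leBDr addrC -leBDr; apply: (vle_trans _ (leUl _ _)).
  apply: leI; rewrite leBDr//.
  by rewrite -[X in vle X _]addr0; apply: leD => //; exact: vle_refl.
- rewrite opprB leBDr; apply: leU.
    apply: (vle_trans (leIl _ _)).
    by rewrite -[X in vle X _]add0r leDr.
  by rewrite -leN opprK opprD addrC leBDr.
Qed.

Variable f : dual E.

Let S x : set R := [set f y | y in [set y | vle (vabs y) x]].
Let s x : R := sup (S x).

Let f_bounded : exists2 M : R, 0 <= M & forall x, `|f x| <= M * `|x|.
Proof.
have /linear_boundedP/pinfty_ex_gt0[M M0 fM] :=
  continuous_linear_bounded 0 (@dual_continuous _ _ f 0).
by exists M => //; exact: ltW.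
Qed.

Let S_has_sup x : vle 0 x -> has_sup (S x).
Proof.
move=> x0; split.
  by exists (f 0), 0 => //=; rewrite vabs_ger0// vle_refl.
have [M M0 fM] := f_bounded; exists (M * `|x|) => _ [y yx <-].
apply: (le_trans (ler_norm _)); apply: (le_trans (fM _)).
by apply: ler_wpM2l => //; exact: ler_norm_abs.
Qed.

Let s_ub x y : vle (vabs y) x -> f y <= s x.
Proof.
move=> yx; apply: sup_ubound; last by exists y.
by have [] := S_has_sup (vle_trans (vabs_ge0 y) yx).
Qed.

Let s_le x b : vle 0 x -> (forall y, vle (vabs y) x -> f y <= b) -> s x <= b.
Proof.
move=> x0 h; apply: ge_sup; first by have [] := S_has_sup x0.
by move=> _ [y yx <-]; exact: h.
Qed.

Let s_ge0 x : vle 0 x -> 0 <= s x.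
Proof.
by move=> x0; rewrite -(linear0 f); apply: s_ub; rewrite vabs_ger0 ?vle_refl.
Qed.

Let vabsD y1 y2 x z : vle (vabs y1) x -> vle (vabs y2) z ->
  vle (vabs (y1 + y2)) (x + z).
Proof.
rewrite !vabs_le => /andP[? ?] /andP[? ?].
by rewrite opprD !leD.
Qed.

Let addr_ge0E x z : vle 0 x -> vle 0 z -> vle 0 (x + z).
Proof. by move=> x0 z0; rewrite -(addr0 0); exact: leD. Qed.

Let sD x z : vle 0 x -> vle 0 z -> s (x + z) = s x + s z.
Proof.
move=> x0 z0; apply/eqP; rewrite eq_le; apply/andP; split.
  apply: s_le; first exact: addr_ge0E.
  move=> y /(riesz_decomposition x0 z0)[y1 [y2 [-> h1 h2]]].
  by rewrite linearD lerD// s_ub.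
rewrite -lerBrDr; apply: s_le => // y1 h1.
rewrite lerBrDr addrC -lerBrDr; apply: s_le => // y2 h2.
by rewrite lerBrDr -linearD; apply: s_ub; rewrite addrC; exact: vabsD.
Qed.

Let scale_le (a : R) x y : 0 <= a -> vle x y -> vle (a *: x) (a *: y).
Proof.
move=> a0 xy; rewrite -[X in vle X _]add0r -leDBr -scalerBr.
by apply: vscale_ge0 => //; rewrite leDBr add0r.
Qed.

Let sZ_le (a : R) x : 0 < a -> vle 0 x -> a * s x <= s (a *: x).
Proof.
move=> a0 x0; rewrite -ler_pdivlMl//; apply: s_le => // y yx.
rewrite ler_pdivlMl// -[a * _]/(a *: (f y : R^o)) -linearZ; apply: s_ub.
move: yx; rewrite !vabs_le -scalerN => /andP[? ?].
by rewrite !scale_le// ltW.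
Qed.

Let sZ (a : R) x : 0 <= a -> vle 0 x -> s (a *: x) = a * s x.
Proof.
rewrite le_eqVlt => /predU1P[<- x0|a0 x0].
  rewrite scale0r mul0r; apply/eqP; rewrite eq_le s_ge0 ?vle_refl// andbT.
  have := sD (vle_refl 0) (vle_refl 0).
  by rewrite addr0 => /eqP; rewrite -subr_eq subrr => /eqP <-.
apply/eqP; rewrite eq_le sZ_le// andbT.
rewrite -ler_pdivrMl//; apply: le_trans (sZ_le _ _) _; rewrite ?invr_gt0//.
  by apply: vscale_ge0 => //; exact: ltW.
by rewrite scalerA mulVf ?gt_eqF// scale1r.
Qed.

Let g x : R^o := s (pos x) - s (pos (- x)).

Let gB a b : vle 0 a -> vle 0 b -> g (a - b) = s a - s b.
Proof.
move=> a0 b0; rewrite /g; set x := a - b.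
have : s (pos x + b) = s (a + pos (- x)).
  have -> : pos x = a - b + pos (- x) by apply/eqP; rewrite -subr_eq posE.
  by rewrite addrAC subrK.
rewrite !sD ?pos_ge0// => h.
by apply/eqP; rewrite subr_eq addrAC eq_sym subr_eq -h.
Qed.

Let g_linear : linear g.
Proof.
have gN x : g (- x) = - g x by rewrite /g opprK opprB.
have gD x y : g (x + y) = g x + g y.
  rewrite -{1}(posE x) -{1}(posE y) addrACA -opprD gB ?addr_ge0E//.
  by rewrite !sD// opprD addrACA.
have gZ a x : 0 <= a -> g (a *: x) = a * g x.
  move=> a0; rewrite -{1}(posE x) scalerBr gB ?vscale_ge0//.
  by rewrite !sZ// -mulrBr.
move=> a x y; rewrite gD; congr (_ + _).
have [a0|a0] := leP 0 a; first exact: gZ.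
by rewrite -[a *: x]opprK -scaleNr gN gZ ?oppr_ge0 1?ltW// mulNr opprK.
Qed.

HB.instance Definition _ := GRing.isLinear.Build R E R^o *:%R g g_linear.

Let g_continuous : continuous g.
Proof.
apply/linear_bounded_continuous/linear_boundedP.
have [M M0 fM] := f_bounded.
have sM x z : vle 0 x -> vle x (vabs z) -> s x <= M * `|z|.
  move=> x0 xz; apply: s_le => // y yx.
  apply: (le_trans (ler_norm _)); apply: (le_trans (fM _)).
  by apply: ler_wpM2l => //; apply: ler_vnorm; exact: vle_trans yx xz.
near=> r => x; rewrite /g.
apply: (le_trans (ler_normB _ _)); rewrite !ger0_norm ?s_ge0//.
apply: (@le_trans _ _ ((M + M) * `|x|)).
  rewrite mulrDl lerD// sM//; apply: leU; rewrite ?vabs_ge0//.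
    exact: leUl.
  exact: leUr.
by apply: ler_wpM2r => //; near: r; apply: nbhs_pinfty_ge; exact: num_real.
Unshelve. all: by end_near. Qed.

Lemma dual_abs_exists : exists h : dual E, is_dual_abs f h.
Proof.
have gE x : vle 0 x -> g x = s x.
  move=> x0; rewrite -[in LHS](subr0 x) gB ?vle_refl//.
  by rewrite -(scale0r (0 : E)) sZ ?vle_refl// mul0r subr0.
exists (Dual g_continuous); split => [x x0|x x0|h fh Nfh x x0] /=.
- by rewrite gE//; apply: s_ub; rewrite vabs_ger0 ?vle_refl.
- rewrite gE// -[X in X <= _]/(- f x) -linearN; apply: s_ub.
  by rewrite -[X in vle _ X](vabs_ger0 x0) /vabs opprK; apply: leU; rewrite ?leUl ?leUr.
- rewrite gE//; apply: s_le => // y yx.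
  have h0 z : vle 0 z -> 0 <= h z.
    move=> z0; have := lerD (fh _ z0) (Nfh _ z0).
    by rewrite -[X in _ + X <= _]/(- f z) subrr -mulr2n pmulrn_lge0.
  apply: (@le_trans _ _ (h (pos y + pos (- y)))).
    rewrite -{1}(posE y) linearB linearD /= lerD ?fh//.
    exact: Nfh.
  rewrite -subr_ge0 -linearB h0// leDBr add0r.
  exact: vle_trans (pos_abs y) yx.
Qed.

End dual_abs_existence.

Definition dual_abs (R : realType) (E : banachLatticeType R) (f : dual E) :
    dual E :=
  projT1 (cid (dual_abs_exists f)).

Lemma dual_absP (R : realType) (E : banachLatticeType R) (f : dual E) :
  is_dual_abs f (dual_abs f).
Proof. exact: (projT2 (cid (dual_abs_exists f))). Qed.

Definition abs_weak_seminorm (R : realType) (E : banachLatticeType R)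
    (f : dual E) (x : E) : R :=
  dual_abs f (vabs x).

(* E with the absolute weak topology in place of the norm topology. *)
Definition abs_weak (R : realType) (E : banachLatticeType R) : Type := E.

Definition abs_weak_ball (R : realType) (E : banachLatticeType R)
    (f : dual E) (a : E) (e : R) : set (abs_weak E) :=
  [set x : E | abs_weak_seminorm f (x - a) < e].

Definition abs_weak_balls (R : realType) (E : banachLatticeType R) :
    set (set (abs_weak E)) :=
  [set U | exists f a, exists2 e : R, 0 < e & U = abs_weak_ball f a e].

HB.instance Definition _ (R : realType) (E : banachLatticeType R) :=
  GRing.Lmodule.copy (abs_weak E) E.
HB.instance Definition _ (R : realType) (E : banachLatticeType R) :=
  isSubBaseTopological.Build (abs_weak E) (@abs_weak_balls R E) id.

Definition abs_weakly_compact (R : realType) (E : banachLatticeType R)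
    (A : set E) : Prop :=
  compact (A : set (abs_weak E)).

Definition abs_weakly_null (R : realType) (E : banachLatticeType R)
    (u : nat -> E) : Prop :=
  (u : nat -> abs_weak E) @ \oo --> (0 : abs_weak E).

Definition weakly_null (R : realType) (E : banachLatticeType R)
    (u : nat -> E) : Prop :=
  forall f : dual E, (f (u n) : R) @[n --> \oo] --> (0 : R).

Definition positive_schur_property (R : realType) (E : banachLatticeType R) :
    Prop :=
  forall u : nat -> E, (forall n, vle 0 (u n)) -> weakly_null u ->
    `|u n| @[n --> \oo] --> (0 : R).

Definition convex_hull (R : realType) (E : banachLatticeType R) (A : set E) :
    set E :=
  \bigcap_(C in [set C : set E | convex_set C /\ A `<=` C]) C.

Definition closed_convex_hull (R : realType) (E : banachLatticeType R)
    (A : set E) : set E :=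
  closure (convex_hull A).

(* Main.v *)
From HB Require Import structures.
Require Import Defs.
From mathcomp Require Import all_boot all_order all_algebra.
From mathcomp Require Import all_classical all_reals all_analysis.
From mathcomp Require Import ring lra.

(** Suppose first that E has the positive Schur property. On an absolutely weakly
    compact set A, sequences have absolutely weakly convergent subsequences
    ([abs_weakly_compact_subsequence], a form of the Eberlein-Smulian theorem).
    The moduli of the differences to the limit are positive and weakly null, so the
    convergence holds in norm. Hence A is norm totally bounded, and Grothendieck's
    construction ([totally_bounded_sub_hull]) puts it in the closed convex hull of a
    norm null sequence.

    Conversely, suppose that the positive Schur property fails. After normalization
    there is a weakly null sequence y of positive vectors of norm 1. Consider the
    set K of all m z, where m >= 1 and z is a convex combination of 0 and the terms
    of y, possibly infinite, with m z of norm at most 1/m ([amplified_hull]). It is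
    absolutely weakly compact: each piece is the image of a compact set of
    coefficients, intersected with a ball, and the pieces shrink to 0
    ([amplified_hull_compact]). It is not contained in the closed convex hull of any
    absolutely weakly null sequence x ([amplified_hull_not_covered]). Indeed, let
    f n be a positive functional of norm at most 1 norming y n, and phi a weak star
    cluster point of the sequence f. A gliding hump selection
    ([almost_disjoint_selection]) yields indices j l for which the sequences
    n |-> (f (j l) - phi) (x n) are almost disjointly supported, so that the sums
    over l < N of the f (j l) - phi are bounded on the terms of x by a constant
    independent of N; here x is bounded in norm ([abs_weakly_null_bounded]). On the
    other hand these sums are at least 1/2 on the y (j i) with i < N, hence on their
    convex combinations, some of which have arbitrarily small norm by Mazur's
    theorem ([weakly_null_small_convex_comb]); multiplied by m, they give elements
    of K on which the sums are at least m/2.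

    The functionals needed in both directions come from the Hahn-Banach theorem
    [sublinear_ge_linear], in the form of the cone separation lemma
    [dual_separation]. *)

Set Implicit Arguments.
Unset Strict Implicit.
Unset Printing Implicit Defensive.

Import Order.TTheory GRing.Theory Num.Theory.
Import numFieldNormedType.Exports.

Local Open Scope classical_set_scope.
Local Open Scope ring_scope.

(** * Sublinear functionals and the Hahn-Banach theorem *)

Section hahn_banach.
Context (R : realType) (E : lmodType R).

Definition sublinear (q : E -> R) :=
  (forall x y, q (x + y) <= q x + q y) /\
  (forall (a : R) x, 0 < a -> q (a *: x) <= a * q x).

Definition cone (D : set (E * R)) :=
  [/\ D (0, 0),
      forall w t v s, D (w, t) -> D (v, s) -> D (w + v, t + s) &
      forall a w t, 0 < a -> D (w, t) -> D (a *: w, a * t)].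

Lemma sublinear0 q : sublinear q -> q 0 = 0.
Proof.
move=> [_ qZ]; have h2 : (0 : R) < 2 by [].
have h2V : (0 : R) < 2^-1 by rewrite invr_gt0.
have := qZ _ 0 h2; have := qZ _ 0 h2V; rewrite !scaler0 => *; lra.
Qed.

Lemma sublinearN q x : sublinear q -> - q (- x) <= q x.
Proof.
move=> sq; have [qD _] := sq.
by have := qD x (- x); rewrite subrr sublinear0// => ?; lra.
Qed.

(** The largest sublinear functional below [q] that is at most [- t] at [- w]
    for all pairs [(w, t)] of the cone [D]. It serves twice: with a ray as [D] it
    shows that minimal sublinear functionals are linear, and with [q] the norm it
    turns lower bounds [t <= `|w|] into lower bounds [t <= f w] for a functional
    [f] of norm at most 1. *)
Definition cone_inf (q : E -> R) (D : set (E * R)) (x : E) : R :=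
  inf [set q (x + d.1) - d.2 | d in D].

Section cone_inf.
Variables (q : E -> R) (D : set (E * R)).
Hypotheses (sq : sublinear q) (cD : cone D).
Hypothesis Dq : forall w t, D (w, t) -> t <= q w.

Let lb x w t : D (w, t) -> - q (- x) <= q (x + w) - t.
Proof.
move=> Dwt; have [qD _] := sq.
by have := qD (x + w) (- x); rewrite addrAC subrr add0r; have := Dq Dwt; lra.
Qed.

Let has_lb x : has_lbound [set q (x + d.1) - d.2 | d in D].
Proof. by exists (- q (- x)) => _ [[w t] Dwt <-]; exact: lb. Qed.

Let non0 x : [set q (x + d.1) - d.2 | d in D] !=set0.
Proof. by exists (q (x + 0) - 0), (0, 0) => //; have [] := cD. Qed.

Lemma cone_inf_le x w t : D (w, t) -> cone_inf q D x <= q (x + w) - t.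
Proof. by move=> Dwt; apply: (ge_inf (has_lb x)); exists (w, t). Qed.

Let inf_ge x b : (forall w t, D (w, t) -> b <= q (x + w) - t) ->
  b <= cone_inf q D x.
Proof.
move=> h; apply: (lb_le_inf (non0 x)) => _ [[w t] Dwt <-]; exact: h.
Qed.

Lemma cone_inf_leq x : cone_inf q D x <= q x.
Proof.
have [D0 _ _] := cD.
by apply: le_trans (cone_inf_le x D0) _; rewrite addr0 subr0.
Qed.

Lemma cone_infN w t : D (w, t) -> cone_inf q D (- w) <= - t.
Proof.
move=> Dwt; apply: le_trans (cone_inf_le _ Dwt) _.
by rewrite addNr sublinear0// sub0r.
Qed.

Lemma sublinear_cone_inf : sublinear (cone_inf q D).
Proof.
have [D0 DD DZ] := cD; have [qD qZ] := sq; split=> [x y|a x a0].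
  rewrite -lerBlDr; apply: inf_ge => w t Dwt.
  rewrite lerBlDl -lerBlDr; apply: inf_ge => v s Dvs.
  have := cone_inf_le (x + y) (DD _ _ _ _ Dwt Dvs).
  by rewrite addrACA; have := qD (x + w) (y + v); lra.
rewrite -ler_pdivrMl//; apply: inf_ge => w t Dwt.
rewrite ler_pdivrMl//; apply: le_trans (cone_inf_le _ (DZ _ _ _ a0 Dwt)) _.
by rewrite -scalerDr mulrBr lerD2r; exact: qZ.
Qed.

End cone_inf.

(** Lowering [q] along the ray spanned by [(y, q y)] cannot change a minimal [q];
    hence [q (- y) <= - q y], so that [q] is odd, and an odd sublinear functional
    is linear. *)
Lemma minimal_sublinear_linear q : sublinear q ->
  (forall r, sublinear r -> (forall x, r x <= q x) -> r = q) -> linear q.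
Proof.
move=> sq qmin; have [qD qZ] := sq.
have qN y : q (- y) = - q y.
  pose D : set (E * R) := [set d | exists2 t, 0 <= t & d = (t *: y, t * q y)].
  have cD : cone D.
    split; first by exists 0 => //; rewrite scale0r mul0r.
    - move=> _ _ _ _ [t t0 [-> ->]] [s s0 [-> ->]].
      by exists (t + s); rewrite ?addr_ge0// scalerDl mulrDl.
    - move=> a _ _ a0 [t t0 [-> ->]]; exists (a * t).
        by rewrite mulr_ge0// ltW.
      by rewrite scalerA mulrA.
  have Dq w t : D (w, t) -> t <= q w.
    move=> [s s0 [-> ->]]; move: s0; rewrite le_eqVlt => /predU1P[<-|s0].
      by rewrite mul0r scale0r sublinear0.
    rewrite -ler_pdivlMl//; apply: le_trans (qZ _ _ _); rewrite ?invr_gt0//.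
    by rewrite scalerA mulVf ?gt_eqF// scale1r.
  have Dy : D (y, q y) by exists 1; rewrite // scale1r mul1r.
  have := cone_infN sq Dq Dy.
  rewrite (qmin _ (sublinear_cone_inf sq cD Dq) (cone_inf_leq sq cD Dq)) => h.
  by apply/eqP; rewrite eq_le h/= -[y in leLHS]opprK; exact: sublinearN.
have qDE x y : q (x + y) = q x + q y.
  apply/eqP; rewrite eq_le qD/=.
  by have := qD (x + y) (- y); rewrite addrK qN; lra.
have qZE a x : 0 < a -> q (a *: x) = a * q x.
  move=> a0; apply/eqP; rewrite eq_le qZ//=.
  rewrite -ler_pdivlMl//; apply: le_trans (qZ _ _ _); rewrite ?invr_gt0//.
  by rewrite scalerA mulVf ?gt_eqF// scale1r.
move=> a x y; rewrite qDE; congr (_ + _).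
have [a0|a0|<-] := ltrgtP 0 a; first exact: qZE.
  by rewrite -[a *: x]opprK -scaleNr qN qZE ?oppr_gt0// mulNr opprK.
by rewrite !scale0r sublinear0.
Qed.

(** Hahn-Banach: *)
(** The Hahn-Banach theorem. Zorn's lemma is applied to the sublinear functionals
    below [q], rather than to partially defined linear ones: the pointwise infimum
    of a chain is again sublinear, and a minimal element is linear. *)
Lemma sublinear_ge_linear q : sublinear q ->
  exists2 f : E -> R, linear f & forall x, f x <= q x.
Proof.
move=> sq; pose T := {r : E -> R | sublinear r /\ forall x, r x <= q x}.
pose ge (r s : T) : bool := `[< forall x, sval s x <= sval r x >].
have [||||[f [sf fq]] fmin] := @Zorn T ge.
- by move=> r; apply/asboolP.
- move=> r s t /asboolP rs /asboolP st; apply/asboolP => x.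
  exact: le_trans (st x) (rs x).
- move=> [r pr] [s ps] /asboolP /= rs /asboolP /= sr.
  have e : r = s by apply/funext => x; apply/eqP; rewrite eq_le sr rs.
  by move: pr; rewrite e => pr; congr exist; exact: Prop_irrelevance.
- move=> A Atot; have [[r0 Ar0]|A0] := pselect (A !=set0); last first.
    exists (exist _ q (conj sq (fun x => lexx (q x)))) => s As.
    by exfalso; apply: A0; exists s.
  pose S x := [set sval r x | r in A].
  have Slb x : has_lbound (S x).
    exists (- q (- x)) => _ [[r [sr rq]] Ar <-] /=.
    by apply: le_trans (sublinearN x sr); rewrite lerN2.
  have infS r x : A r -> inf (S x) <= sval r x.
    by move=> Ar; apply: (ge_inf (Slb x)); exists r.
  have geS x b : (forall r, A r -> b <= sval r x) -> b <= inf (S x).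
    move=> h; apply: lb_le_inf; first by exists (sval r0 x), r0.
    by move=> _ [r Ar <-]; exact: h.
  have sS : sublinear (fun x => inf (S x)).
    split=> [x y|a x a0].
      rewrite -lerBlDr; apply: (geS _ _) => r Ar; rewrite lerBlDl -lerBlDr.
      apply: (geS _ _) => s As; rewrite lerBlDl.
      have [/asboolP rs|/asboolP sr] := Atot _ _ Ar As.
        apply: le_trans (infS s _ As) _; have [[sD _] _] := svalP s.
        by apply: le_trans (sD x y) _; rewrite lerD.
      apply: le_trans (infS r _ Ar) _; have [[rD _] _] := svalP r.
      by apply: le_trans (rD x y) _; rewrite lerD.
    rewrite -ler_pdivrMl//; apply: (geS _ _) => r Ar; rewrite ler_pdivrMl//.
    by apply: le_trans (infS r _ Ar) _; have [[_ rZ] _] := svalP r; exact: rZ.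
  have Sq x : inf (S x) <= q x.
    by apply: le_trans (infS r0 _ Ar0) _; have [_] := svalP r0; exact.
  exists (exist _ (fun x => inf (S x)) (conj sS Sq)) => r Ar.
  by apply/asboolP => x /=; exact: infS.
exists f => //; apply: minimal_sublinear_linear => // r sr rf.
have rq x : r x <= q x by exact: le_trans (rf x) (fq x).
have rf' : ge (exist _ f (conj sf fq)) (exist _ r (conj sr rq)).
  exact/asboolP.
exact: (congr1 sval (fmin _ rf')).
Qed.

End hahn_banach.

(** * Vector lattices, dual functionals and the absolute weak seminorms *)

Section vector_lattice.
Context (R : realType) (E : banachLatticeType R).
Implicit Types x y z : E.

Lemma vleD x y z t : vle x y -> vle z t -> vle (x + z) (y + t).
Proof.
move=> xy zt; apply: (@vle_trans _ _ (y + z)); first exact: vleD2r.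
by rewrite ![y + _]addrC; exact: vleD2r.
Qed.

Lemma vsub_ge0 x y : vle 0 (y - x) = vle x y.
Proof.
apply/idP/idP => [/(vleD2r x)|/(vleD2r (- x))].
  by rewrite add0r subrK.
by rewrite subrr.
Qed.

Lemma vaddr_ge0 x y : vle 0 x -> vle 0 y -> vle 0 (x + y).
Proof. by move=> x0 y0; rewrite -(addr0 0); exact: vleD. Qed.

Lemma vle_vabs x : vle x (vabs x).
Proof. by have := vle_refl (vabs x); rewrite {1}/vabs vleUx => /andP[]. Qed.

Lemma vleN_vabs x : vle (- x) (vabs x).
Proof. by have := vle_refl (vabs x); rewrite {1}/vabs vleUx => /andP[]. Qed.

Lemma vabs_le x y : vle x y -> vle (- x) y -> vle (vabs x) y.
Proof. by rewrite /vabs vleUx => -> ->. Qed.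

Lemma vscale_le (a : R) x y : 0 <= a -> vle x y -> vle (a *: x) (a *: y).
Proof.
move=> a0; rewrite -(vsub_ge0 x) -(vsub_ge0 (a *: x)) -scalerBr.
exact: vscale_ge0.
Qed.

(** Both [`|x| - x] and [`|x| + x] are positive, and their sum is [2 `|x|]. *)
Lemma vabs_ge0 x : vle 0 (vabs x).
Proof.
have := vaddr_ge0 (x := vabs x - x) (y := vabs x + x).
rewrite vsub_ge0 vle_vabs -{2}[x]opprK vsub_ge0 vleN_vabs => /(_ isT isT).
have h : 0 <= 2^-1 :> R by rewrite invr_ge0.
rewrite addrACA addNr addr0 => /(vscale_ge0 _ _ h).
by rewrite -mulr2n -[vabs x *+ 2]scaler_nat scalerA mulVf ?scale1r// pnatr_eq0.
Qed.

Lemma vabs_ger0 x : vle 0 x -> vabs x = x.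
Proof.
move=> x0; apply: vle_anti; rewrite vle_vabs andbT; apply: vabs_le.
  exact: vle_refl.
apply: (vle_trans _ x0).
by rewrite -[X in vle _ X]addr0 -vsub_ge0 addr0 sub0r opprK.
Qed.

Lemma vabsN x : vabs (- x) = vabs x.
Proof.
apply: vle_anti; apply/andP; split; apply: vabs_le; rewrite ?opprK;
  rewrite ?vle_vabs ?vleN_vabs//.
by rewrite -[in X in vle X _](opprK x) vleN_vabs.
Qed.

Lemma vabsD x y : vle (vabs (x + y)) (vabs x + vabs y).
Proof.
by apply: vabs_le; rewrite ?opprD; apply: vleD; rewrite ?vle_vabs ?vleN_vabs.
Qed.

Lemma vabs_vabs x : vabs (vabs x) = vabs x.
Proof. by rewrite vabs_ger0// vabs_ge0. Qed.

Lemma norm_vabs x : `|vabs x| = `|x|.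
Proof.
by apply/eqP; rewrite eq_le !ler_vnorm// -?[vjoin _ _]/(vabs _) ?vabs_vabs;
   exact: vle_refl.
Qed.

Lemma ler_norm_vle x y : vle 0 x -> vle x y -> `|x| <= `|y|.
Proof.
move=> x0 xy; apply: ler_vnorm; rewrite -!/(vabs _).
by rewrite !vabs_ger0//; exact: vle_trans xy.
Qed.

Lemma vabsZ_le (a : R) x : vle (vabs (a *: x)) (`|a| *: vabs x).
Proof.
wlog a0 : a x / 0 <= a.
  move=> h; have [|a0] := leP 0 a; first exact: h.
  rewrite -normrN -[a *: x]opprK -scaleNr vabsN; apply: h.
  by rewrite oppr_ge0 ltW.
rewrite ger0_norm//; apply: vabs_le; rewrite -?scalerN; apply: vscale_le => //.
  exact: vle_vabs.
exact: vleN_vabs.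
Qed.

End vector_lattice.

Section dual_functionals.
Context (R : realType) (E : banachLatticeType R).
Implicit Types (f g : dual E) (x y z : E).

Lemma dual_of_bounded (f : E -> R) (M : R) : linear (f : E -> R^o) ->
  (forall x, `|f x| <= M * `|x|) -> exists g : dual E, forall x, g x = f x.
Proof.
move=> lf fM.
pose F : {linear E -> R^o} :=
  HB.pack (f : E -> R^o) (GRing.isLinear.Build R E R^o *:%R f lf).
have cF : continuous F.
  apply/linear_bounded_continuous/linear_boundedP.
  apply: filterS (nbhs_pinfty_ge (num_real M)) => r /= Mr x.
  by apply: (le_trans (fM x)); exact: ler_wpM2r.
by exists (Dual cF).
Qed.

Lemma dual_bounded f : exists2 M : R, 0 < M & forall x, `|f x| <= M * `|x|.
Proof.
have /linear_boundedP/pinfty_ex_gt0[M M0 fM] :=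
  continuous_linear_bounded 0 (@dual_continuous _ _ f 0).
by exists M.
Qed.

Lemma dualD f x y : f (x + y) = f x + f y. Proof. exact: linearD. Qed.
Lemma dualB f x y : f (x - y) = f x - f y. Proof. exact: linearB. Qed.
Lemma dualN f x : f (- x) = - f x. Proof. exact: linearN. Qed.
Lemma dualZ f (a : R) x : f (a *: x) = a * f x. Proof. exact: linearZ. Qed.
Lemma dual0 f : f 0 = 0. Proof. exact: linear0. Qed.

(** The form in which Hahn-Banach is used throughout: each application only has to
    exhibit the right cone. Pairs [(v, 0)] in [D] force [0 <= f v], pairs
    [(w, `|w|)] force [f] to norm [w]. *)
Lemma dual_separation (D : set (E * R)) : cone D ->
  (forall w t, D (w, t) -> t <= `|w|) ->
  exists f : dual E, (forall x, `|f x| <= `|x|) /\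
                     forall w t, D (w, t) -> t <= f w.
Proof.
move=> cD Dn.
have sn : sublinear (fun x : E => `|x|).
  by split=> [x y|a x a0]; rewrite ?ler_normD// normrZ gtr0_norm.
have [f lf fD] := sublinear_ge_linear (sublinear_cone_inf sn cD Dn).
have fle x : f x <= `|x| by apply: le_trans (fD x) _; exact: cone_inf_leq.
have fN x : f (- x) = - f x.
  have := lf (-1) x 0; rewrite addr0 scaleN1r => ->.
  have := lf 1 0 0; rewrite scaler0 addr0 scale1r => /eqP.
  rewrite -subr_eq subrr => /eqP <-.
  by rewrite addr0 scaleN1r.
have [g gf] : exists g : dual E, forall x, g x = f x.
  apply: (@dual_of_bounded _ 1) => // x; rewrite mul1r ler_norml fle andbT.
  by rewrite lerNl -fN -[leRHS]normrN fle.
exists g; split=> [x|w t Dwt]; rewrite gf.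
  by rewrite ler_norml fle andbT lerNl -fN -[leRHS]normrN fle.
rewrite -lerN2 -fN; apply: le_trans (fD _) _; exact: cone_infN.
Qed.

Definition positive_dual f := forall x, vle 0 x -> 0 <= f x.

Lemma positive_dual_le f x y : positive_dual f -> vle x y -> f x <= f y.
Proof. by move=> f0; rewrite -vsub_ge0 => /f0; rewrite dualB subr_ge0. Qed.

(** The cone consists of the pairs [(s x + v, s `|x|)] with [s] and [v] positive;
    the bound [s `|x| <= `|s x + v|] is the monotonicity of the norm. *)
Lemma positive_norming x : vle 0 x -> exists f : dual E,
  [/\ positive_dual f, forall y, `|f y| <= `|y| & f x = `|x|].
Proof.
move=> x0.
pose D : set (E * R) := [set d | exists s v, [/\ 0 <= s, vle 0 v &
  d = (s *: x + v, s * `|x|)]].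
have cD : cone D.
  split.
  - exists 0, 0; split; rewrite ?vle_refl//.
    by rewrite scale0r addr0 mul0r.
  - move=> _ _ _ _ [s [v [s0 v0 [-> ->]]]] [t [w [t0 w0 [-> ->]]]].
    exists (s + t), (v + w); split; rewrite ?addr_ge0 ?vaddr_ge0//.
    by rewrite scalerDl mulrDl addrACA.
  - move=> a _ _ a0 [s [v [s0 v0 [-> ->]]]].
    exists (a * s), (a *: v); split.
    + by rewrite mulr_ge0// ltW.
    + by apply: vscale_ge0 => //; exact: ltW.
    + by rewrite scalerDr scalerA mulrA.
have Dn w t : D (w, t) -> t <= `|w|.
  move=> [s [v [s0 v0 [-> ->]]]].
  rewrite -[s in leLHS]ger0_norm// -normrZ; apply: ler_norm_vle.
    exact: vscale_ge0.
  by rewrite -{1}[s *: x]addr0; apply: vleD; rewrite ?vle_refl.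
have [f [fn fD]] := dual_separation cD Dn.
exists f; split=> // [v v0|].
  by apply: fD; exists 0, v; split; rewrite // scale0r add0r mul0r.
apply/eqP; rewrite eq_le (le_trans (ler_norm _) (fn x))/=.
apply: fD; exists 1, 0; split; rewrite ?vle_refl//.
by rewrite scale1r addr0 mul1r.
Qed.

Local Notation p := abs_weak_seminorm.

Lemma positive_dual_abs f : positive_dual (dual_abs f).
Proof.
move=> x x0; have [h1 h2 _] := dual_absP f.
by have := h1 x x0; have := h2 x x0; rewrite /= -[(- _) x]/(- f x); lra.
Qed.

Lemma abs_weak_seminorm_ge0 f x : 0 <= p f x.
Proof. by apply: positive_dual_abs; exact: vabs_ge0. Qed.

Lemma abs_weak_seminormN f x : p f (- x) = p f x.
Proof. by rewrite /p vabsN. Qed.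

Lemma abs_weak_seminormBC f x y : p f (x - y) = p f (y - x).
Proof. by rewrite -opprB abs_weak_seminormN. Qed.

Lemma abs_weak_seminorm0 f : p f 0 = 0.
Proof. by rewrite /p vabs_ger0 ?vle_refl// dual0. Qed.

Lemma abs_weak_seminormD f x y : p f (x + y) <= p f x + p f y.
Proof.
rewrite /p -dualD; apply: positive_dual_le; first exact: positive_dual_abs.
exact: vabsD.
Qed.

Lemma abs_weak_seminorm_triangle f x y z :
  p f (x - z) <= p f (x - y) + p f (y - z).
Proof.
have -> : x - z = (x - y) + (y - z) by rewrite addrA subrK.
exact: abs_weak_seminormD.
Qed.

Lemma abs_weak_seminormZ f (a : R) x : p f (a *: x) <= `|a| * p f x.
Proof.
rewrite /p -dualZ; apply: positive_dual_le; first exact: positive_dual_abs.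
exact: vabsZ_le.
Qed.

Lemma abs_weak_seminorm_sum f (u : nat -> E) n :
  p f (\sum_(i < n) u i) <= \sum_(i < n) p f (u i).
Proof.
elim/big_rec2: _ => [|i y x _ h]; first by rewrite abs_weak_seminorm0.
by apply: le_trans (abs_weak_seminormD _ _ _) _; rewrite lerD2l.
Qed.

Lemma dual_abs_ge f x : vle 0 x -> f x <= dual_abs f x.
Proof. by have [h _ _] := dual_absP f; exact: h. Qed.

(** The absolute weak topology is finer than the weak one. With [g] the modulus of
    [f], add the inequalities [f <= g] at [`|y| + y] and [- f <= g] at
    [`|y| - y]; both points are positive, and the sum is [2 f y <= 2 g `|y|]. *)
Lemma dual_le_abs_weak_seminorm f x : `|f x| <= p f x.
Proof.
suff h y : f y <= p f y.
  by rewrite ler_norml h andbT lerNl -dualN -abs_weak_seminormN h.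
have [h1 h2 _] := dual_absP f.
have a1 : vle 0 (vabs y + y) by rewrite -{2}[y]opprK vsub_ge0 vleN_vabs.
have a2 : vle 0 (vabs y - y) by rewrite vsub_ge0 vle_vabs.
have := h1 _ a1; have := h2 _ a2.
rewrite -[(- _) (vabs _ - _)]/(- f (vabs y - y)) !dualB !dualD /p; lra.
Qed.

Lemma abs_weak_seminorm_bounded f :
  exists2 M : R, 0 < M & forall x, p f x <= M * `|x|.
Proof.
have [M M0 fM] := dual_bounded (dual_abs f); exists M => // x.
by apply: le_trans (ler_norm _) _; apply: le_trans (fM _) _; rewrite norm_vabs.
Qed.

Lemma nbhs_abs_weak_ball f (z : abs_weak E) (e : R) : 0 < e ->
  nbhs z (abs_weak_ball f (z : E) e).
Proof.
move=> e0; rewrite nbhsE; exists (abs_weak_ball f (z : E) e) => //.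
split; last by rewrite /abs_weak_ball /= subrr abs_weak_seminorm0.
exists [set abs_weak_ball f (z : E) e]; last by rewrite bigcup_set1.
move=> _ -> /=; apply: finI_from1.
by exists f, (z : E), e.
Qed.

(** The subbase of the topology contains balls with arbitrary centres; by the
    triangle inequality the balls centred at the limit suffice. *)
Lemma filter_abs_weak_cvg (F : set_system E) (z : E) : Filter F ->
  (forall f (e : R), 0 < e -> F [set x | p f (x - z) < e]) ->
  (F : set_system (abs_weak E)) --> (z : abs_weak E).
Proof.
move=> FF h A; rewrite nbhsE => -[U [[D' D'sub <-] [B D'B Bz]] UA].
apply: filterS UA _; have [S SD BE] := D'sub _ D'B.
apply: (@filterS _ _ _ B); first by move=> x Bx; exists B.
rewrite -BE; apply: filter_bigI => i iS.
have := SD i iS; rewrite inE => -[f [a [e e0 ie]]].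
have iz : i z by move: Bz; rewrite -BE => /(_ _ iS).
move: iz; rewrite ie /abs_weak_ball /= => paz.
have := h f (e - p f (z - a)); rewrite subr_gt0 => /(_ paz).
apply: filterS => x /= px.
by apply: le_lt_trans (abs_weak_seminorm_triangle f x z a) _; lra.
Qed.

Lemma abs_weakly_null_seminorm (u : nat -> E) :
  abs_weakly_null u <-> forall f, p f (u n) @[n --> \oo] --> (0 : R).
Proof.
split=> [u0 f|h].
  apply/cvgrPdist_lt => e e0.
  have h : \forall n \near \oo, p f (u n - 0) < e.
    exact: (u0 _ (nbhs_abs_weak_ball f (0 : abs_weak E) e0)).
  apply: filterS h => n; rewrite subr0 sub0r normrN.
  by rewrite ger0_norm ?abs_weak_seminorm_ge0.
apply: filter_abs_weak_cvg => f e e0.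
have /cvgrPdist_lt/(_ e e0) := h f.
apply: filterS => n /=; rewrite sub0r normrN subr0.
by rewrite ger0_norm ?abs_weak_seminorm_ge0.
Qed.

End dual_functionals.

(** * Series of functionals and boundedness of absolutely weakly null sequences *)

(** Dependent choice with memory: the selections below constrain each new term
    against all the earlier ones. *)
Lemma history_choice T (Q : seq T -> T -> Prop) :
  (forall s, exists x, Q s x) ->
  exists u : nat -> T, forall n, Q (mkseq u n) (u n).
Proof.
move=> /choice[c Qc]; pose s n := iter n (fun l => rcons l (c l)) [::].
exists (fun n => c (s n)) => n; suff -> : mkseq (fun n => c (s n)) n = s n.
  exact: Qc.
by elim: n => // n IHn; rewrite mkseqS IHn.
Qed.

Section half_powers.
Context {R : realType}.

Lemma halfX_gt0 n : 0 < 2^-1 ^+ n :> R.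
Proof. by rewrite exprn_gt0// invr_gt0. Qed.

Lemma sum_halfX_le n : \sum_(i < n) 2^-1 ^+ i <= 2 :> R.
Proof.
suff -> : \sum_(i < n) 2^-1 ^+ i = 2 - 2 * 2^-1 ^+ n :> R.
  by rewrite gerBl mulr_ge0// ltW// halfX_gt0.
elim: n => [|n IHn]; first by rewrite big_ord0 expr0; ring.
by rewrite big_ord_recr/= IHn exprS; field.
Qed.

Lemma cvg_halfX : 2^-1 ^+ n @[n --> \oo] --> (0 : R).
Proof. by apply: cvg_expr; rewrite gtr0_norm ?invr_gt0// invf_lt1// ltr1n. Qed.

End half_powers.

Section series_of_functionals.
Context (R : realType) (E : banachLatticeType R).

(** The functional is the sum of the series of the [2^-k g k]; since the terms are
    positive, the sum dominates each of them on the positive cone. *)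
Lemma dual_series (g : nat -> dual E) :
  (forall k, positive_dual (g k)) -> (forall k x, `|g k x| <= `|x|) ->
  exists f : dual E, forall k x, vle 0 x -> 2^-1 ^+ k * g k x <= f x.
Proof.
move=> g0 gn; pose a x k : R := 2^-1 ^+ k * g k x.
have cg (x : E) : cvgn (series (geometric `|x| (2^-1 : R))).
  by apply: is_cvg_geometric_series; rewrite gtr0_norm ?invr_gt0// invf_lt1// ltr1n.
have an x k : `|a x k| <= geometric `|x| (2^-1 : R) k.
  by rewrite /a /geometric/= normrM gtr0_norm ?halfX_gt0// mulrC ler_pM2r ?halfX_gt0.
have cna x : cvgn [normed series (a x)].
  apply: series_le_cvg (cg x) => n; [exact: normr_ge0| |exact: an].
  exact: le_trans (normr_ge0 _) (an x n).
have ca x : cvgn (series (a x)) by apply: normed_cvg; exact: cna.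
pose F x := limn (series (a x)).
have lF : linear (F : E -> R^o).
  move=> c x y; apply: cvg_lim => //.
  have -> : series (a (c *: x + y)) = (fun n => c * series (a x) n + series (a y) n).
    apply/funext => n; rewrite /series/= mulr_sumr -big_split/=.
    by apply: eq_bigr => k _; rewrite /a dualD dualZ; ring.
  by apply: cvgD; [apply: cvgMr|]; exact: ca.
have [f fF] : exists f : dual E, forall x, f x = F x.
  apply: (@dual_of_bounded _ _ _ 2) => // x.
  apply: le_trans (lim_series_norm (cna x)) _.
  apply: limr_le; first exact: cna.
  apply: nearW => n; rewrite /series/=.
  apply: (@le_trans _ _ (\sum_(0 <= k < n) geometric `|x| (2^-1 : R) k)).
    exact: ler_sum.
  rewrite /geometric/= -mulr_sumr mulrC ler_wpM2r// big_mkord; exact: sum_halfX_le.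
exists f => k x x0; have a0 n : 0 <= a x n.
  by rewrite mulr_ge0 ?g0// ltW// halfX_gt0.
rewrite fF; apply: le_trans (_ : series (a x) k.+1 <= _).
  by rewrite /series/= big_nat_recr//= lerDr sumr_ge0.
apply: nondecreasing_cvgn_le (ca x) _; apply: nondecreasing_series => *.
exact: a0.
Qed.

(** If [`|u (m k)| > 4^k] and [g k] is a positive functional norming [u (m k)],
    then the functional dominating all the [2^-k g k] is at least [2^k] on the
    modulus of [u (m k)], although its values along the moduli tend to 0. *)
Lemma abs_weakly_null_bounded (u : nat -> E) : abs_weakly_null u ->
  exists M : R, forall n, `|u n| <= M.
Proof.
move=> /abs_weakly_null_seminorm u0; apply: contrapT => unb.
have /choice[m um] k : exists n, 4 ^+ k < `|u n|.
  apply: contrapT => h; apply: unb; exists (4 ^+ k) => n.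
  by rewrite leNgt; apply/negP => un; apply: h; exists n.
have /choice[g gP] k := positive_norming (vabs_ge0 (u (m k))).
have [f fg] := dual_series (g := g) (fun k => let: And3 h _ _ := gP k in h)
  (fun k => let: And3 _ h _ := gP k in h).
have /cvgP/cvg_seq_bounded/bounded_fun_has_ubound[C fC] := u0 f.
have [k Ck] : exists k : nat, C < k%:R.
  by exists (Num.truncn C).+1; rewrite truncnS_gt.
have := fg k _ (vabs_ge0 (u (m k))).
have [_ _ ->] := gP k; rewrite norm_vabs.
move=> h; have {}h : 2^-1 ^+ k * `|u (m k)| <= C.
  apply: le_trans h _; apply: le_trans (dual_abs_ge f (vabs_ge0 _)) _.
  by apply: fC; exists (m k).
have := lt_le_trans _ h; move=> /(_ (2^-1 ^+ k * 4 ^+ k)).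
rewrite ltr_pM2l ?halfX_gt0// um => /(_ isT).
have -> : 2^-1 ^+ k * 4 ^+ k = 2 ^+ k :> R.
  by rewrite -exprMn; congr (_ ^+ _); field.
apply/negP; rewrite -leNgt; apply: le_trans (ltW Ck) _.
by rewrite -natrX ler_nat ltnW// ltn_expl.
Qed.

End series_of_functionals.

(** * From the positive Schur property to closed convex hulls *)

Section normed.
Context (R : realType) (E : normedModType R).

Lemma closure_normP (A : set E) (z : E) :
  closure A z <-> forall e : R, 0 < e -> exists2 y, A y & `|z - y| < e.
Proof.
split=> [clz e e0|h B].
  by have [y [Ay]] := clz _ (nbhsx_ballx z e e0); rewrite -ball_normE; exists y.
move=> /nbhs_ballP[e e0 eB]; have [y Ay zy] := h e e0.
by exists y; split=> //; apply: eB; rewrite -ball_normE.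
Qed.

End normed.

Section rational_span.
Context (R : realType) (E : banachLatticeType R) (x : nat -> E).

(** Coefficients are rational so that these combinations can be enumerated. *)
Definition rat_comb (s : seq (nat * rat)) : E :=
  \sum_(q <- s) ratr q.2 *: x q.1.

Definition closed_span : set E := closure (range rat_comb).

Lemma rat_comb_span s : closed_span (rat_comb s).
Proof. by apply: subset_closure; exists s. Qed.

Lemma closed_span0 : closed_span 0.
Proof. by have := @rat_comb_span [::]; rewrite /rat_comb big_nil. Qed.

Lemma closed_span_term n : closed_span (x n).
Proof.
have := @rat_comb_span [:: (n, 1)].
by rewrite /rat_comb big_seq1/= rmorph1 scale1r.
Qed.

Lemma closed_spanD y z : closed_span y -> closed_span z -> closed_span (y + z).
Proof.
move=> /closure_normP yS /closure_normP zS; apply/closure_normP => e e0.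
have e2 : 0 < e / 2 by rewrite divr_gt0.
have [_ [s _ <-] ys] := yS _ e2; have [_ [t _ <-] zt] := zS _ e2.
exists (rat_comb (s ++ t)); first by exists (s ++ t).
rewrite /rat_comb big_cat/= opprD addrACA.
by apply: le_lt_trans (ler_normD _ _) _; rewrite [e]splitr; exact: ltrD.
Qed.

(** Only rational multiples preserve the combinations, so [a] is approximated by a
    rational and [y] by a combination at the same time. *)
Lemma closed_spanZ (a : R) y : closed_span y -> closed_span (a *: y).
Proof.
move=> /closure_normP yS; apply/closure_normP => e e0.
have d0 : 0 < Num.min 1 (e / 2 / (`|a| + 1)).
  by rewrite lt_min ltr01 !divr_gt0// ltr_wpDl.
have [_ [s _ <-] ys] := yS _ d0.
have h0 : 0 < e / 2 / (`|rat_comb s| + 1) by rewrite !divr_gt0// ltr_wpDl.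
have [r /andP[ar1 ar2]] : exists r : rat, a < ratr r < a + e / 2 / (`|rat_comb s| + 1).
  have [|r] := @rat_in_itvoo R a (a + e / 2 / (`|rat_comb s| + 1)) _.
    by rewrite ltrDl.
  by rewrite in_itv; exists r.
pose t := [seq (q.1, r * q.2) | q <- s].
exists (rat_comb t); first by exists t.
have -> : rat_comb t = ratr r *: rat_comb s.
  rewrite /rat_comb big_map scaler_sumr; apply: eq_bigr => q _ /=.
  by rewrite rmorphM/= scalerA.
have -> : a *: y - ratr r *: rat_comb s =
    a *: (y - rat_comb s) + (a - ratr r) *: rat_comb s.
  by rewrite scalerBr scalerBl addrA subrK.
apply: le_lt_trans (ler_normD _ _) _; rewrite !normrZ [e]splitr.
rewrite lt_min in ys; case/andP: ys => _ ys.
apply: ler_ltD; last first.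
  rewrite distrC gtr0_norm ?subr_gt0//.
  have := ar2; rewrite -ltrBlDl ltr_pdivlMr ?ltr_wpDl// => h.
  apply: le_lt_trans h; apply: ler_wpM2l; last by rewrite lerDl.
  by rewrite subr_ge0 ltW.
move: ys; rewrite ltr_pdivlMr ?ltr_wpDl// => /ltW h.
by apply: le_trans h; rewrite mulrC ler_wpM2l// lerDl.
Qed.

(** Separation by the cone of the pairs [(s z + y, s d)] with [y] in the span,
    where [d] is a positive lower bound of the distances from [z] to the span. *)
Lemma annihilator_closed_span z : ~ closed_span z ->
  exists2 f : dual E, 0 < f z & forall n, f (x n) = 0.
Proof.
move=> zS.
have [d d0 dz] : exists2 d : R, 0 < d & forall y, closed_span y -> d <= `|z - y|.
  apply: contrapT => h; apply: zS; apply/closure_normP => e e0.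
  apply: contrapT => h'; apply: h; exists (e / 2); first by rewrite divr_gt0.
  move=> y /closure_normP/(_ (e / 2))[|w wS yw]; first by rewrite divr_gt0.
  rewrite leNgt; apply/negP => zy; apply: h'; exists w => //.
  have -> : z - w = (z - y) + (y - w) by rewrite addrA subrK.
  by apply: le_lt_trans (ler_normD _ _) _; rewrite [e]splitr; exact: ltrD.
pose D : set (E * R) := [set u | exists s y, [/\ 0 <= s, closed_span y &
  u = (s *: z + y, s * d)]].
have cD : cone D.
  split.
  - exists 0, 0; split => //; first exact: closed_span0.
    by rewrite scale0r addr0 mul0r.
  - move=> _ _ _ _ [s [v [s0 v0 [-> ->]]]] [t [w [t0 w0 [-> ->]]]].
    exists (s + t), (v + w); split; [exact: addr_ge0|exact: closed_spanD|].
    by rewrite scalerDl mulrDl addrACA.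
  - move=> a _ _ a0 [s [v [s0 v0 [-> ->]]]].
    exists (a * s), (a *: v); split.
    + by rewrite mulr_ge0// ltW.
    + exact: closed_spanZ.
    + by rewrite scalerDr scalerA mulrA.
have Dn w t : D (w, t) -> t <= `|w|.
  move=> [s [v [s0 v0 [-> ->]]]]; move: s0; rewrite le_eqVlt => /predU1P[<-|s0].
    by rewrite mul0r.
  have -> : s *: z + v = s *: (z - (- s^-1) *: v).
    by rewrite scalerBr scalerA mulrN mulfV ?gt_eqF// scaleN1r opprK.
  rewrite normrZ gtr0_norm// ler_pM2l//; apply: dz; exact: closed_spanZ.
have [f [_ fD]] := dual_separation cD Dn.
exists f => [|n].
  apply: lt_le_trans d0 _; apply: fD; exists 1, 0; split=> //.
    exact: closed_span0.
  by rewrite scale1r addr0 mul1r.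
have f0 y : closed_span y -> 0 <= f y.
  by move=> yS; apply: fD; exists 0, y; split; rewrite // scale0r add0r mul0r.
apply/eqP; rewrite eq_le f0 ?andbT; last exact: closed_span_term.
rewrite -oppr_ge0 -dualN f0// -scaleN1r; apply: closed_spanZ.
exact: closed_span_term.
Qed.

(** The closed span is a norm closed subspace, hence weakly closed. *)
Lemma weak_limit_closed_span z :
  (forall (f : dual E) (e : R), 0 < e ->
    exists n, abs_weak_seminorm f (x n - z) < e) ->
  closed_span z.
Proof.
move=> zx; apply: contrapT => /annihilator_closed_span[f fz fx].
have [n] := zx f _ fz; rewrite ltNge => /negP; apply.
rewrite abs_weak_seminormBC; apply: le_trans (dual_le_abs_weak_seminorm _ _).
by rewrite dualB fx subr0 ler_norm.
Qed.

(** On a separable subspace a single seminorm separates points: sum with weights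
    [2^-k] positive functionals [g k] norming the moduli of a dense sequence [w].
    If the sum vanishes on [`|z|], so does each [g k], and [w k] close to [z] gives
    [`|w k| = g k `|w k| <= g k `|w k - z| <= `|w k - z|], which is small. *)
Lemma separating_seminorm : exists g : dual E,
  forall z, closed_span z -> abs_weak_seminorm g z = 0 -> z = 0.
Proof.
pose w k := if unpickle k is Some s then rat_comb s else 0.
have /choice[g gP] k := positive_norming (vabs_ge0 (w k)).
have [f fg] := dual_series (g := g) (fun k => let: And3 h _ _ := gP k in h)
  (fun k => let: And3 _ h _ := gP k in h).
exists f => z /closure_normP zS fz.
have gz k : g k (vabs z) <= 0.
  rewrite -(pmulr_rle0 _ (halfX_gt0 k)); apply: le_trans (fg k _ (vabs_ge0 _)) _.
  by rewrite -fz; apply: dual_abs_ge; exact: vabs_ge0.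
apply/eqP; rewrite -normr_le0; apply/ler_addgt0Pl => e e0; rewrite addr0.
have [|_ [s _ <-] zs] := zS (e / 2); first by rewrite divr_gt0.
have [gp gn] := gP (pickle s); rewrite /w pickleK norm_vabs => gs.
have : `|rat_comb s| <= e / 2.
  rewrite -gs; have -> : rat_comb s = (rat_comb s - z) + z by rewrite subrK.
  apply: le_trans (positive_dual_le gp (vabsD _ _)) _.
  rewrite dualD -[leRHS]addr0 lerD//; apply: le_trans (ler_norm _) _.
  by apply: le_trans (gn _) _; rewrite norm_vabs distrC ltW.
have := ler_normD (z - rat_comb s) (rat_comb s); rewrite subrK; lra.
Qed.

End rational_span.

Section eberlein_smulian.
Context (R : realType) (E : banachLatticeType R).
Local Notation p := abs_weak_seminorm.

Lemma abs_weakly_compact_cluster (A : set E) (x : nat -> E) :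
  abs_weakly_compact A -> (forall n, A (x n)) ->
  exists2 z, A z & forall (f : dual E) (e : R) N, 0 < e ->
    exists2 n, (N <= n)%N & p f (x n - z) < e.
Proof.
move=> cA Ax.
have [|z [Az zx]] := cA ((x : nat -> abs_weak E) @ \oo).
  by exists 0%N => // n _; exact: Ax.
exists z => // f e N e0.
have Nx : ((x : nat -> abs_weak E) @ \oo) (x @` [set n | (N <= n)%N]).
  by exists N => // n /= Nn; exists n.
have [_ [[n Nn <-] xn]] := zx _ _ Nx (nbhs_abs_weak_ball f z e0).
by exists n.
Qed.

(** The part of the Eberlein-Smulian theorem that is needed. Let [a] be a cluster
    point of [x] and [g] separate the points of the closed span of [x]. A
    subsequence is chosen along which the [g]-seminorm of [x - a] tends to 0. All
    cluster points of its subsequences lie in the span and have [g]-distance 0 from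
    [a], so they are [a], and compactness gives convergence. *)
Lemma abs_weakly_compact_subsequence (A : set E) (x : nat -> E) :
  abs_weakly_compact A -> (forall n, A (x n)) ->
  exists a (m : nat -> nat), {homo m : i j / (i < j)%N} /\
    abs_weakly_null (fun k => x (m k) - a).
Proof.
move=> cA Ax; have [a Aa ax] := abs_weakly_compact_cluster cA Ax.
have [g gsep] := separating_seminorm x.
(* The next index exceeds the previous ones and brings [x] [g]-close to [a]. *)
pose Q (s : seq nat) n := (forall i, i \in s -> i < n)%N /\
  p g (x n - a) < 2^-1 ^+ size s.
have [s|m mQ] := @history_choice _ Q.
  have [n sn xn] := ax g _ (\max_(i <- s) i).+1 (halfX_gt0 (size s)).
  exists n; split=> // i si; apply: leq_ltn_trans sn.
  by rewrite (big_rem _ si) /= leq_maxl.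
have mg k : p g (x (m k) - a) < 2^-1 ^+ k.
  by have [_] := mQ k; rewrite size_mkseq.
exists a, m; split=> [i j ij|].
  by have [h _] := mQ j; apply: h; apply/mapP; exists i; rewrite // mem_iota.
have aS : closed_span x a.
  apply: weak_limit_closed_span => f e e0.
  by have [n _ xn] := ax f e 0%N e0; exists n.
apply/abs_weakly_null_seminorm => f; apply/cvgrPdist_lt => e e0.
apply: contrapT => nf.
have /choice[k kP] N : exists k, (N <= k)%N /\ e <= p f (x (m k) - a).
  apply: contrapT => h; apply: nf; exists N => // k /= Nk.
  rewrite sub0r normrN ger0_norm ?abs_weak_seminorm_ge0//.
  by rewrite ltNge; apply/negP => fk; apply: h; exists k.
have [z Az zx] := abs_weakly_compact_cluster cA (fun N => Ax (m (k N))).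
have zS : closed_span x z.
  apply: weak_limit_closed_span => h d d0.
  by have [n _ xn] := zx h d 0%N d0; exists (m (k n)).
have zaS : closed_span x (z - a).
  by apply: closed_spanD => //; rewrite -scaleN1r; exact: closed_spanZ.
have /subr0_eq za : z - a = 0.
  apply: gsep => //; apply/eqP; rewrite eq_le abs_weak_seminorm_ge0 andbT.
  apply/ler_addgt0Pl => d d0; rewrite addr0.
  have d2 : 0 < d / 2 by rewrite divr_gt0.
  have /cvgrPdist_lt/(_ _ d2)[N _ Nd] := @cvg_halfX R.
  have [n Nn xn] := zx g _ N d2.
  have [nk _] := kP n.
  have := Nd (k n) (leq_trans Nn nk).
  rewrite /= sub0r normrN gtr0_norm ?halfX_gt0// => kd.
  have := mg (k n); have := abs_weak_seminorm_triangle g z (x (m (k n))) a.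
  by rewrite (abs_weak_seminormBC g z (x _)); lra.
have [n _] := zx f e 0%N e0; have [_] := kP n; rewrite za; lra.
Qed.

End eberlein_smulian.

Section grothendieck.
Context (R : realType) (E : banachLatticeType R).

(** The moduli of an absolutely weakly null sequence form a positive weakly null
    sequence with the same norms. *)
Lemma positive_schur_norm_null : positive_schur_property E ->
  forall u : nat -> E, abs_weakly_null u -> `|u n| @[n --> \oo] --> (0 : R).
Proof.
move=> psp u /abs_weakly_null_seminorm u0.
have := psp (fun n => vabs (u n)) (fun n => vabs_ge0 (u n)).
have -> : (fun n => `|vabs (u n)|) = (fun n => `|u n|).
  by apply/funext => n; rewrite norm_vabs.
apply=> f; have := u0 f; move=> /cvgrPdist_lt h; apply/cvgrPdist_lt => e /h.
apply: filterS => n; rewrite !sub0r !normrN => /le_lt_trans; apply.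
apply: le_trans (dual_le_abs_weak_seminorm _ _) _.
by rewrite /abs_weak_seminorm vabs_vabs ler_norm.
Qed.

Definition norm_totally_bounded (A : set E) := forall e : R, 0 < e ->
  exists s : seq E, forall x, A x -> exists2 y, y \in s & `|x - y| < e.

(** A sequence with mutual distances at least [e] would have an absolutely weakly
    convergent subsequence, which converges in norm by the Schur property. *)
Lemma positive_schur_totally_bounded (A : set E) : positive_schur_property E ->
  abs_weakly_compact A -> norm_totally_bounded A.
Proof.
move=> psp cA e e0; apply: contrapT => nb.
pose Q (s : seq E) x := A x /\ forall y, y \in s -> e <= `|x - y|.
have [s|x xQ] := @history_choice _ Q.
  apply: contrapT => h; apply: nb; exists s => x Ax.
  apply: contrapT => h'; apply: h; exists x; split=> // y ys.
  by rewrite leNgt; apply/negP => xy; apply: h'; exists y.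
have Ax n : A (x n) by have [] := xQ n.
have xe i j : (i < j)%N -> e <= `|x j - x i|.
  move=> ij; have [_] := xQ j; apply.
  by apply/mapP; exists i; rewrite // mem_iota.
have [a [m [m_incr /(positive_schur_norm_null psp)]]] :=
  abs_weakly_compact_subsequence cA Ax.
have e2 : 0 < e / 2 by rewrite divr_gt0.
move=> /cvgrPdist_lt/(_ _ e2)[N _ Nx].
have := Nx N (leqnn N); have := Nx N.+1 (leqnSn N).
rewrite !sub0r !normrN !normr_id.
have := xe _ _ (m_incr _ _ (ltnSn N)).
have := ler_normB (x (m N.+1) - a) (x (m N) - a).
by rewrite opprB addrA subrK; lra.
Qed.

Lemma convex_half (C : set E) y z : convex_set C -> C y -> C z ->
  C (2^-1 *: (y + z)).
Proof.
move=> cC Cy Cz; have l1 : (2^-1 : R) <= 1 by rewrite invf_le1// ler1n.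
have l0 : (0 : R) <= 2^-1 by rewrite invr_ge0.
have := cC y z (Itv01 l0 l1); rewrite !inE => /(_ Cy Cz).
rewrite -[conv _ _ _]/(2^-1 *: y + (1 - 2^-1) *: z).
have -> : 1 - 2^-1 = 2^-1 :> R by field.
by rewrite scalerDr.
Qed.

Lemma convex_dyadic_sum (C : set E) (g : nat -> E) n : convex_set C -> C 0 ->
  (forall k, C (g k)) -> C (\sum_(k < n) 2^-1 ^+ k.+1 *: g k).
Proof.
move=> cC C0; elim: n g => [|n IHn] g Cg; first by rewrite big_ord0.
rewrite big_ord_recl/= expr1.
have -> : \sum_(i < n) 2^-1 ^+ (bump 0 i).+1 *: g (bump 0 i) =
    2^-1 *: (\sum_(i < n) 2^-1 ^+ i.+1 *: g i.+1).
  by rewrite scaler_sumr; apply: eq_bigr => i _; rewrite scalerA -exprS.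
rewrite -scalerDr; apply: convex_half => //.
by apply: (IHn (fun k => g k.+1)) => k; exact: Cg.
Qed.

(** The radius of the first net is a bound of [A], which makes the zero vector
    a net: all approximations then start from 0. *)
Lemma totally_bounded_nets (A : set E) : norm_totally_bounded A ->
  exists (B : R) (net : nat -> seq E), [/\ 0 < B, net 0%N = [:: 0] &
    forall k x, A x -> exists2 y, y \in net k & `|x - y| <= B * 2^-1 ^+ (k + k)].
Proof.
move=> tb; have [s sA] := tb 1 ltr01.
pose B := 1 + \sum_(y <- s) `|y|.
have B0 : 0 < B by rewrite ltr_pwDl// sumr_ge0.
have /choice[net netP] k : exists t : seq E, forall x, A x ->
    exists2 y, y \in t & `|x - y| < B * 2^-1 ^+ (k + k).
  by apply: tb; rewrite mulr_gt0// halfX_gt0.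
exists B, (fun k => if k is 0%N then [:: 0] else net k); split=> // -[|k] x Ax.
  exists 0; first by rewrite inE.
  rewrite subr0 mulr1; have [y ys xy] := sA x Ax.
  rewrite -(subrK y x); apply: le_trans (ler_normD _ _) _.
  rewrite lerD ?(ltW xy)// (big_rem _ ys)/= lerDl; exact: sumr_ge0.
by have [y yn xy] := netP k.+1 x Ax; exists y => //; exact: ltW.
Qed.

(** Grothendieck's argument. Let [a k] be a point of the [k]-th net within
    [B 4^-k] of [x], with [a 0 = 0]. Then [x] is the limit of the sums of the
    [2^-(k+1) g k] with [g k = 2^(k+1) (a (k+1) - a k)]. The vectors [g k] have
    norm at most [4 B 2^-k] and are taken from finitely many for each [k], so all
    of them can be arranged in one norm null sequence. *)
Lemma totally_bounded_sub_hull (A : set E) : norm_totally_bounded A ->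
  exists2 u : nat -> E, `|u n| @[n --> \oo] --> (0 : R) &
    A `<=` closed_convex_hull (range u).
Proof.
move=> /totally_bounded_nets[B [net [B0 net0 netP]]].
pose step (t : nat * nat * nat) : E := let: (k, i, j) := t in
  2 ^+ k.+1 *: (nth 0 (net k.+1) i - nth 0 (net k) j).
(* Triples that are out of range or not short stand for 0, so that the k-th
   block has finitely many nonzero terms, of norm at most 4 B 2^-k. *)
pose short (t : nat * nat * nat) := let: (k, i, j) := t in
  [&& (i < size (net k.+1))%N, (j < size (net k))%N &
      `|step t| <= 4 * B * 2^-1 ^+ k].
pose u n := if pickle_inv n is Some t then if short t then step t else 0 else 0.
have u0 : range u 0.
  exists (pickle (0, size (net 1), 0)%N) => //.
  by rewrite /u pickleK_inv /short ltnn.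
exists u => [|x Ax].
  apply/cvgrPdist_lt => e e0.
  have eB : 0 < e / (4 * B) by rewrite divr_gt0// mulr_gt0.
  have /cvgrPdist_lt/(_ _ eB)[K _ KP] := @cvg_halfX R.
  pose N := \max_(k < K) \max_(i < size (net k.+1)) \max_(j < size (net k))
    pickle (nat_of_ord k, nat_of_ord i, nat_of_ord j).
  exists N.+1 => // n /= Nn; rewrite sub0r normrN normr_id /u.
  case nt : (pickle_inv n) => [[[k i] j]|]; last by rewrite normr0.
  case: ifPn => [/and3P[ik jk]|_]; last by rewrite normr0.
  move=> /le_lt_trans; apply; have [Kk|kK] := leqP K k.
    have := KP k Kk; rewrite /= sub0r normrN gtr0_norm ?halfX_gt0//.
    by rewrite ltr_pdivlMr ?mulr_gt0// mulrC.
  have := @pickle_invK (nat * nat * nat)%type n; rewrite nt /= => nE.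
  exfalso; move: Nn; rewrite -nE ltnNge => /negP; apply.
  rewrite /N; apply: leq_trans (leq_bigmax (Ordinal kK)).
  apply: leq_trans (leq_bigmax (Ordinal ik)).
  exact: leq_trans (leq_bigmax (Ordinal jk)).
have /choice[a aP] k : exists y, y \in net k /\ `|x - y| <= B * 2^-1 ^+ (k + k).
  by have [y yn xy] := netP k x Ax; exists y.
have a0 : a 0%N = 0 by have [] := aP 0%N; rewrite net0 inE => /eqP.
pose g k := 2 ^+ k.+1 *: (a k.+1 - a k).
have gu k : range u (g k).
  have [an xa] := aP k; have [an1 xa1] := aP k.+1.
  pose t := (k, index (a k.+1) (net k.+1), index (a k) (net k)).
  have tg : step t = g k by rewrite /t /step /= !nth_index.
  exists (pickle t) => //; rewrite /u pickleK_inv ifT ?tg//.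
  rewrite -[short t]/[&& (index (a k.+1) (net k.+1) < size (net k.+1))%N,
    (index (a k) (net k) < size (net k))%N & `|step t| <= 4 * B * 2^-1 ^+ k].
  rewrite !index_mem an an1 tg /=.
  rewrite /g normrZ gtr0_norm ?exprn_gt0//.
  have h : `|a k.+1 - a k| <= 2 * B * 2^-1 ^+ (k + k).
    have -> : a k.+1 - a k = (x - a k) - (x - a k.+1).
      by rewrite opprB [RHS]addrC addrA subrK.
    apply: le_trans (ler_normB _ _) _.
    rewrite -mulrA mulr_natl mulr2n lerD//; apply: le_trans xa1 _.
    rewrite ler_pM2l//; apply: ler_wiXn2l; rewrite ?invr_ge0 ?invf_le1 ?ler1n//.
    by rewrite leq_add.
  apply: le_trans (ler_wpM2l _ h) _; first by rewrite exprn_ge0.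
  rewrite le_eqVlt; apply/orP; left; apply/eqP.
  rewrite exprD exprS exprVn; field.
  by rewrite expf_neq0.
have ga n : \sum_(k < n) 2^-1 ^+ k.+1 *: g k = a n.
  elim: n => [|n IHn]; first by rewrite big_ord0 a0.
  rewrite big_ord_recr/= IHn /g scalerA exprVn mulVf ?expf_neq0// scale1r.
  by rewrite addrC subrK.
apply/closure_normP => e e0.
have eB : 0 < e / B by rewrite divr_gt0.
have /cvgrPdist_lt/(_ _ eB)[K _ KP] := @cvg_halfX R.
exists (a K).
  move=> C [cC uC]; rewrite -ga; apply: convex_dyadic_sum => //.
    exact: uC.
  by move=> k; exact: uC.
have [_ /le_lt_trans] := aP K; apply.
have := KP (K + K)%N (leq_addr _ _).
by rewrite /= sub0r normrN gtr0_norm ?halfX_gt0// ltr_pdivlMr// mulrC.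
Qed.

Lemma norm_null_abs_weakly_null (u : nat -> E) :
  `|u n| @[n --> \oo] --> (0 : R) -> abs_weakly_null u.
Proof.
move=> u0; apply/abs_weakly_null_seminorm => f.
have [M M0 fM] := abs_weak_seminorm_bounded f.
apply: (squeeze_cvgr (f := fun=> 0) (h := fun n => M * `|u n|)).
- by apply: nearW => n; rewrite abs_weak_seminorm_ge0 fM.
- exact: cvg_cst.
- by rewrite -(mulr0 M); apply: cvgMr.
Qed.

Lemma positive_schur_sub_hull : positive_schur_property E ->
  forall A : set E, abs_weakly_compact A ->
    exists2 u : nat -> E, abs_weakly_null u &
      A `<=` closed_convex_hull (range u).
Proof.
move=> psp A cA.
have [u u0 Au] :=
  totally_bounded_sub_hull (positive_schur_totally_bounded psp cA).
by exists u => //; exact: norm_null_abs_weakly_null.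
Qed.

End grothendieck.

(** * Limits of functionals along ultrafilters and small convex combinations *)

Section ultrafilter_limits.
Context {R : realType}.

Lemma ultrafilter_limit T (F : set_system T) (h : T -> R) (c d : R) :
  UltraFilter F -> F [set x | c <= h x <= d] ->
  exists2 b, c <= b <= d & forall e, 0 < e -> F [set x | `|h x - b| < e].
Proof.
move=> FU Fh.
have [|b [+ hb]] := @segment_compact R c d (h @ F).
  apply: (@filterS _ F _ [set x | c <= h x <= d]) Fh => x /= xcd.
  by rewrite in_itv.
rewrite /= in_itv /= => cbd; exists b => // e e0.
have [//|FN] := in_ultra_setVsetC [set x | `|h x - b| < e] FU.
have hFN : (h @ F) [set r | ~ `|r - b| < e] by exact: FN.
have [r [rN]] := hb _ _ hFN (nbhsx_ballx b e e0).
by rewrite -ball_normE /= distrC.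
Qed.

End ultrafilter_limits.

Section functional_limits.
Context (R : realType) (E : banachLatticeType R).

(** A weak star cluster point of a bounded sequence of functionals; pointwise
    limits along an ultrafilter exist by compactness of intervals. *)
Lemma dual_ultrafilter_limit (F : set_system nat) (f : nat -> dual E) :
  UltraFilter F -> (forall n x, `|f n x| <= `|x|) ->
  exists2 phi : dual E, (forall x, `|phi x| <= `|x|) &
    forall x (e : R), 0 < e -> F [set n | `|f n x - phi x| < e].
Proof.
move=> FU fn.
have /choice[phi phiP] x : exists b, - `|x| <= b <= `|x| /\
    forall e : R, 0 < e -> F [set n | `|f n x - b| < e].
  have [|b xb bP] := ultrafilter_limit (h := fun n => f n x) (c := - `|x|) (d := `|x|) FU.
    by apply: nearW => n /=; rewrite -ler_norml.
  by exists b.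
have lphi : linear (phi : E -> R^o).
  move=> a x y; apply/eqP; rewrite -subr_eq0 -normr_le0.
  apply/ler_addgt0Pl => e e0; rewrite addr0.
  pose d := e / (`|a| + 2).
  have d0 : 0 < d by rewrite divr_gt0// ltr_wpDl.
  have [_ /(_ d d0) h1] := phiP (a *: x + y).
  have [_ /(_ d d0) h2] := phiP x; have [_ /(_ d d0) h3] := phiP y.
  have [n [/= [k1 k2] k3]] := filter_ex (filterI (filterI h1 h2) h3).
  have -> : e = d + `|a| * d + d by rewrite /d; field; rewrite gt_eqF// ltr_wpDl.
  have -> : phi (a *: x + y) - (a *: phi x + phi y : R^o) =
      - (f n (a *: x + y) - phi (a *: x + y)) + a * (f n x - phi x)
      + (f n y - phi y).
    by rewrite dualD dualZ -[a *: phi x]/(a * phi x); ring.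
  apply: le_trans (ler_normD _ _) _; rewrite lerD ?(ltW k3)//.
  apply: le_trans (ler_normD _ _) _; rewrite normrN lerD ?(ltW k1)//.
  by rewrite normrM ler_wpM2l// ltW.
have phin x : `|phi x| <= `|x| by rewrite ler_norml; have [] := phiP x.
have [g gphi] : exists g : dual E, forall x, g x = phi x.
  by apply: (@dual_of_bounded _ _ phi 1) => // x; rewrite mul1r.
exists g => x; first by rewrite gphi.
by move=> e e0; rewrite gphi; have [_] := phiP x; exact.
Qed.

Definition comb (y : nat -> E) (s : seq (nat * R)) : E :=
  \sum_(q <- s) q.2 *: y q.1.

(** Mazur's theorem for the point 0. If all convex combinations had norm above
    [d], the pairs of a positive combination and of [d] times its total weight
    would form a cone as in [dual_separation], giving a functional that is at least
    [d] on every [y n]. *)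
Lemma weakly_null_small_convex_comb (y : nat -> E) (d : R) :
  weakly_null y -> 0 < d ->
  exists s : seq (nat * R), [/\ forall q, q \in s -> 0 <= q.2,
    \sum_(q <- s) q.2 = 1 & `|comb y s| <= d].
Proof.
move=> y0 d0; apply: contrapT => nos.
pose D : set (E * R) := [set u | exists s : seq (nat * R),
  (forall q, q \in s -> 0 <= q.2) /\ u = (comb y s, d * \sum_(q <- s) q.2)].
have combZ a s : comb y [seq (q.1, a * q.2) | q <- s] = a *: comb y s.
  rewrite /comb big_map scaler_sumr; apply: eq_bigr => q _ /=.
  by rewrite scalerA.
have sumZ a s : \sum_(q <- [seq (q.1, a * q.2) | q <- s : seq (nat * R)]) q.2 =
    a * \sum_(q <- s) q.2.
  by rewrite big_map mulr_sumr.
have geZ a s : 0 <= a -> (forall q, q \in s -> 0 <= q.2) ->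
    forall q, q \in [seq (q.1, a * q.2) | q <- s : seq (nat * R)] -> 0 <= q.2.
  by move=> a0 s0 q /mapP[r /s0 r0 ->]; exact: mulr_ge0.
have cD : cone D.
  split.
  - by exists [::]; split => //; rewrite /comb !big_nil mulr0.
  - move=> _ _ _ _ [s [s0 [-> ->]]] [t [t0 [-> ->]]]; exists (s ++ t); split.
      by move=> q; rewrite mem_cat => /orP[/s0|/t0].
    by rewrite /comb !big_cat/= mulrDr.
  - move=> a _ _ a0 [s [s0 [-> ->]]].
    exists [seq (q.1, a * q.2) | q <- s]; split; first exact: geZ (ltW a0) s0.
    by rewrite combZ sumZ mulrCA.
have Dn w t : D (w, t) -> t <= `|w|.
  move=> [s [s0 [-> ->]]]; set c := \sum_(q <- s) q.2.
  have : 0 <= c by rewrite /c big_seq sumr_ge0.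
  rewrite le_eqVlt => /predU1P[<-|c0]; first by rewrite mulr0.
  rewrite leNgt; apply/negP => sc; apply: nos.
  exists [seq (q.1, c^-1 * q.2) | q <- s]; split.
  - by apply: geZ => //; rewrite invr_ge0 ltW.
  - by rewrite sumZ mulVf// gt_eqF.
  - rewrite combZ normrZ gtr0_norm ?invr_gt0// ler_pdivrMl// mulrC.
    exact: ltW.
have [f [_ fD]] := dual_separation cD Dn.
have fy n : d <= f (y n).
  apply: fD; exists [:: (n, 1)]; split; first by move=> q; rewrite inE => /eqP->.
  by rewrite /comb !big_seq1/= scale1r mulr1.
have /cvgrPdist_lt/(_ _ d0)[N _ /(_ N (leqnn N))] := y0 f.
by rewrite /= sub0r normrN ltNge (le_trans (fy N))// ler_norm.
Qed.

Lemma dual_le_closed_convex_hull (h : dual E) (A : set E) (c : R) :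
  (forall x, A x -> h x <= c) -> forall x, closed_convex_hull A x -> h x <= c.
Proof.
move=> hA x /closure_normP xA; apply/ler_addgt0Pr => e e0.
have [M M0 hM] := dual_bounded h.
have [|y yA xy] := xA (e / M); first by rewrite divr_gt0.
have hy : h y <= c.
  apply: (yA [set z | h z <= c]); split; last exact: hA.
  move=> a b l; rewrite !inE /= => ha hb.
  rewrite -[conv _ _ _]/(l%:num *: a + (1 - l%:num) *: b) dualD !dualZ.
  have l1 : 0 <= 1 - l%:num by rewrite subr_ge0.
  have -> : c = l%:num * c + (1 - l%:num) * c by ring.
  by rewrite lerD// ler_wpM2l.
rewrite -(subrK y x) dualD addrC lerD//.
apply: le_trans (ler_norm _) _; apply: le_trans (hM _) _.
by rewrite -ler_pdivlMl// mulrC ltW.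
Qed.

End functional_limits.

(** * An absolutely weakly compact set built from a sequence *)

Section positive_series.
Context (R : realType) (E : banachLatticeType R) (y : nat -> E).
Hypothesis y_norm : forall n, `|y n| <= 1.
Hypothesis y_null : forall f : dual E,
  abs_weak_seminorm f (y n) @[n --> \oo] --> (0 : R).
Local Notation p := abs_weak_seminorm.

Definition series_coef (c : R) (a : nat -> R) :=
  (forall n, 0 <= a n) /\ forall N, \sum_(n < N) a n <= c.

(** Sums of positive series with total weight at most [c]: this is [c] times the
    closed convex hull of 0 and the [y n]. It is described by coefficients
    because compactness is checked on them. *)
Definition series_hull (c : R) : set E :=
  [set x | exists2 a, series_coef c a &
    (\sum_(n < N) a n *: y n) @[N --> \oo] --> x].

Lemma series_hull0 c : 0 <= c -> series_hull c 0.
Proof.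
move=> c0.
exists (fun=> 0); first by split=> // N; rewrite big1.
have -> : (fun N => \sum_(n < N) 0 *: y n) = (fun=> 0).
  by apply/funext => N; rewrite big1// => i _; rewrite scale0r.
exact: cvg_cst.
Qed.

Lemma series_hull_term c n : 0 <= c -> series_hull c (c *: y n).
Proof.
move=> c0; exists (fun k => if k == n then c else 0); first split=> [k|N].
- by case: ifP.
- rewrite -big_mkcond/=; have [nN|Nn] := ltnP n N.
    by rewrite (big_pred1 (Ordinal nN)).
  rewrite big_pred0// => i; apply/negP => /eqP iN.
  by move: (ltn_ord i); rewrite iN ltnNge Nn.
- apply: cvg_near_cst; exists n.+1 => // N /= nN.
  rewrite (bigD1 (Ordinal nN))//= eqxx big1 ?addr0// => i.
  by rewrite -val_eqE /= => /negPf ->; rewrite scale0r.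
Qed.

Lemma series_hullD c d x z : series_hull c x -> series_hull d z ->
  series_hull (c + d) (x + z).
Proof.
move=> [a [a0 ac] ax] [b [b0 bd] bz]; exists (fun n => a n + b n).
  split=> [n|N] /=; first exact: addr_ge0.
  by rewrite big_split/=; exact: lerD (ac N) (bd N).
have -> : (fun N => \sum_(n < N) (a n + b n) *: y n) =
    (fun N => \sum_(n < N) a n *: y n + \sum_(n < N) b n *: y n).
  apply/funext => N; rewrite -big_split/=.
  by apply: eq_bigr => i _; rewrite scalerDl.
exact: cvgD.
Qed.

Lemma series_hull_comb (j : nat -> nat) (s : seq (nat * R)) :
  (forall q, q \in s -> 0 <= q.2) ->
  series_hull (\sum_(q <- s) q.2) (comb (y \o j) s).
Proof.
elim: s => [|q s IHs] s0.
  by rewrite /comb !big_nil; exact: series_hull0.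
rewrite /comb !big_cons; apply: series_hullD.
  by apply: series_hull_term; apply: s0; rewrite inE eqxx.
by apply: IHs => r rs; apply: s0; rewrite inE rs orbT.
Qed.

Lemma cvg_positive_series c (a : nat -> R) : series_coef c a ->
  exists x : E, (\sum_(n < N) a n *: y n) @[N --> \oo] --> x.
Proof.
move=> [a0 ac]; have -> : (fun N => \sum_(n < N) a n *: y n) =
    series (fun n => a n *: y n).
  by apply/funext => N; rewrite /series/= big_mkord.
suff /cvg_ex : cvgn (series (fun n => a n *: y n)) by [].
apply: normed_cvg.
apply: (@series_le_cvg _ _ a) => [n|n|n|]; [exact: normr_ge0|exact: a0| |].
  by rewrite /= normrZ ger0_norm// ler_piMr.
apply: nondecreasing_is_cvgn; first exact: nondecreasing_series.
by exists c => _ [n _ <-]; rewrite /series/= big_mkord.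
Qed.

Lemma seminorm_lim_le (f : dual E) (v : nat -> E) x (C : R) :
  v N @[N --> \oo] --> x -> (\forall N \near \oo, p f (v N) <= C) ->
  p f x <= C.
Proof.
move=> vx vC; have [M M0 fM] := abs_weak_seminorm_bounded f.
apply/ler_addgt0Pr => e e0.
have eM : 0 < e / M by rewrite divr_gt0.
have /cvgrPdist_lt/(_ _ eM) xv := vx.
have [N [/= vNC vNx]] := filter_ex (filterI vC xv).
rewrite -(subrK (v N) x) addrC; apply: le_trans (abs_weak_seminormD _ _ _) _.
rewrite lerD//; apply: le_trans (fM _) _.
by rewrite -ler_pdivlMl// mulrC ltW.
Qed.

(** The first [N] terms are controlled by the coefficients, and the later ones by
    the smallness of the [y n]. *)
Lemma seminorm_series_le (f : dual E) (N P : nat) (eta c d : R) (a b : nat -> R) :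
  (N <= P)%N -> 0 <= eta -> (forall n, (N <= n)%N -> p f (y n) <= eta) ->
  series_coef c a -> series_coef d b ->
  p f (\sum_(n < P) (a n - b n) *: y n) <=
    \sum_(n < N) `|a n - b n| * p f (y n) + eta * (c + d).
Proof.
move=> NP eta0 hN [a0 ac] [b0 bd].
apply: le_trans (abs_weak_seminorm_sum f (fun n => (a n - b n) *: y n) P) _.
apply: (@le_trans _ _ (\sum_(n < P) `|a n - b n| * p f (y n))).
  by apply: ler_sum => i _; exact: abs_weak_seminormZ.
rewrite -(subnKC NP) big_split_ord/= lerD2l.
apply: (@le_trans _ _ (\sum_(n < P - N) eta * (a (N + n)%N + b (N + n)%N))).
  apply: ler_sum => i _; rewrite mulrC; apply: ler_pM => //.
  - exact: abs_weak_seminorm_ge0.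
  - by apply: hN; exact: leq_addr.
  - by apply: le_trans (ler_normB _ _) _; rewrite !ger0_norm.
rewrite -mulr_sumr ler_wpM2l// big_split/= lerD//.
  apply: le_trans (ac P); rewrite -[in leRHS](subnKC NP) big_split_ord/=.
  by rewrite lerDr sumr_ge0.
apply: le_trans (bd P); rewrite -[in leRHS](subnKC NP) big_split_ord/=.
by rewrite lerDr sumr_ge0.
Qed.

(** Norm balls are closed for the absolute weak topology: test the limit [z] against
    a positive functional norming its modulus. *)
Lemma norm_ball_abs_weak_limit (F : set_system E) (r : R) z : ProperFilter F ->
  (forall (f : dual E) e, 0 < e -> F [set x | p f (x - z) < e]) ->
  F [set x | `|x| <= r] -> `|z| <= r.
Proof.
move=> FF Fz Fr; apply/ler_addgt0Pr => e e0.
have [f [f0 fn fz]] := positive_norming (vabs_ge0 z).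
have [x [/= xr xz]] := filter_ex (filterI Fr (Fz f e e0)).
rewrite -[leLHS]norm_vabs -fz -(subrK x z) addrC.
apply: le_trans (positive_dual_le f0 (vabsD _ _)) _; rewrite dualD lerD//.
  by apply: le_trans (ler_norm _) _; apply: le_trans (fn _) _; rewrite norm_vabs.
apply: le_trans (dual_abs_ge f (vabs_ge0 _)) _.
by rewrite -/(abs_weak_seminorm f (z - x)) abs_weak_seminormBC ltW.
Qed.

(** The series hull is the image of a compact set of coefficient sequences. Along an
    ultrafilter each coefficient has a limit [b n], and the seminorm of the
    difference between [x] and the series of the [b n] is small by
    [seminorm_series_le], because [y] is absolutely weakly null. *)
Lemma series_hull_ultra_limit c (F : set_system E) : UltraFilter F ->
  F (series_hull c) -> exists2 z, series_hull c z &
    forall (f : dual E) e, 0 < e -> F [set x | p f (x - z) < e].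
Proof.
move=> FU Fc.
have /choice[a aP] (x : E) : exists a, series_hull c x -> series_coef c a /\
    (\sum_(n < N) a n *: y n) @[N --> \oo] --> x.
  have [[a ca ax]|nx] := pselect (series_hull c x); first by exists a.
  by exists (fun=> 0).
have Fa : F [set x | series_coef c (a x)].
  by apply: filterS Fc => x /aP[].
have /choice[b bP] n : exists b, 0 <= b /\
    forall e : R, 0 < e -> F [set x | `|a x n - b| < e].
  have [|b /andP[b0 _] bP] := ultrafilter_limit (h := a^~ n) (c := 0) (d := c) FU.
    apply: filterS Fa => x [a0 ac] /=; rewrite a0/=.
    by apply: le_trans (ac n.+1); rewrite big_ord_recr/= lerDr sumr_ge0.
  by exists b.
have Fsum (w : nat -> R) N (e : R) : (forall n, 0 <= w n) -> 0 < e ->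
    F [set x | \sum_(n < N) `|a x n - b n| * w n < e].
  move=> w0 e0; pose W := \sum_(n < N) w n + 1.
  have W0 : 0 < W by rewrite ltr_wpDl// sumr_ge0.
  have : \forall x \near F, forall n : 'I_N, `|a x n - b n| < e / W.
    by apply: filter_forall => n; have [_] := bP n; apply; rewrite divr_gt0.
  apply: filterS => x /= xb.
  apply: (@le_lt_trans _ _ (\sum_(n < N) e / W * w n)).
    by apply: ler_sum => n _; rewrite ler_wpM2r// ltW.
  rewrite -mulr_sumr mulrAC ltr_pdivrMr// ltr_pM2l//.
  by rewrite ltrDl.
have cb : series_coef c b.
  split=> [n|N]; first by have [] := bP n.
  apply/ler_addgt0Pr => e e0.
  have [x [/= [a0 ac] xb]] := filter_ex (filterI Fa (Fsum (fun=> 1) N e (fun=> ler01) e0)).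
  apply: (@le_trans _ _ (\sum_(n < N) (a x n + `|a x n - b n| * 1))).
    apply: ler_sum => n _; rewrite mulr1 -lerBlDl distrC.
    exact: ler_norm.
  by rewrite big_split; exact: lerD (ac N) (ltW xb).
have [z bz] := cvg_positive_series cb.
exists z => [|f e e0]; first by exists b.
have c0 : 0 <= c by have [_ /(_ 0%N)] := cb; rewrite big_ord0.
pose eta := e / 4 / (c + c + 1).
have eta0 : 0 < eta by rewrite !divr_gt0// ltr_wpDl// addr_ge0.
have /cvgrPdist_lt/(_ _ eta0)[N _ hN] := y_null f.
have e4 : 0 < e / 4 by rewrite divr_gt0.
have FS := Fsum (fun n => p f (y n)) N (e / 4)
  (fun n => abs_weak_seminorm_ge0 f (y n)) e4.
apply: filterS (filterI Fc FS) => x [/aP[ca ax] xN] /=.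
apply: (@le_lt_trans _ _ (e / 4 + eta * (c + c))).
  have dx : (\sum_(n < P) (a x n - b n) *: y n) @[P --> \oo] --> x - z.
    have -> : (fun P => \sum_(n < P) (a x n - b n) *: y n) =
        (fun P => \sum_(n < P) a x n *: y n - \sum_(n < P) b n *: y n).
      apply/funext => P; rewrite -sumrB.
      by apply: eq_bigr => i _; rewrite scalerBl.
    exact: cvgB.
  apply: seminorm_lim_le dx _; exists N => // P /= NP.
  apply: le_trans (seminorm_series_le NP (ltW eta0) _ ca cb) _.
    move=> n /hN; rewrite /= sub0r normrN ger0_norm ?abs_weak_seminorm_ge0//.
    exact: ltW.
  by rewrite lerD2r ltW.
have : eta * (c + c) <= e / 4.
  by rewrite /eta mulrAC ler_pdivrMr ?ltr_wpDl ?addr_ge0// ler_wpM2l ?ltW// ltrDl.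
by lra.
Qed.

(** Multiples of convex combinations of the [y n] by arbitrarily large factors,
    provided that they are short. Because of the large factors, functionals
    that exceed a fixed positive constant on enough of the [y n] are not uniformly
    bounded on this set, whereas the decreasing norms keep it compact. By Mazur's
    theorem convex combinations that are short enough for each factor occur along
    every subsequence. *)
Definition amplified_hull : set E :=
  [set x | exists m : nat, series_hull m.+1%:R x /\ `|x| <= m.+1%:R^-1].

(** An ultrafilter on the set either contains one of the pieces of the union, which
    are compact, or avoids all of them and then converges to 0 in norm. *)
Lemma amplified_hull_compact : abs_weakly_compact amplified_hull.
Proof.
rewrite /abs_weakly_compact compact_ultra => F FU FK.
suff [z zK Fz] : exists2 z, amplified_hull z &
    forall (f : dual E) e, 0 < e -> F [set x | p f (x - z) < e].
  by exists z; split=> //; exact: filter_abs_weak_cvg.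
pose Km m : set E :=
  [set x | series_hull m.+1%:R x /\ `|x| <= m.+1%:R^-1].
have [[m Fm]|nFm] := pselect (exists m, F (Km m)).
  have [z zS Fz] : exists2 z, series_hull m.+1%:R z &
      forall (f : dual E) e, 0 < e -> F [set x | p f (x - z) < e].
    by apply: series_hull_ultra_limit => //; apply: filterS Fm => x [].
  exists z => //; exists m; split=> //.
  by apply: norm_ball_abs_weak_limit Fz _; apply: filterS Fm => x [].
exists 0.
  by exists 0%N; split; [exact: series_hull0|rewrite normr0 invr_ge0].
move=> f e e0; have [M M0 fM] := abs_weak_seminorm_bounded f.
have [N NM] : exists N : nat, M / e < N.+1%:R.
  by exists (Num.truncn (M / e)); rewrite truncnS_gt.
(* Outside the first N pieces the norm is at most 1 / (N + 1). *)
have FN : \forall x \near F, forall m : 'I_N, (~` Km m) x.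
  apply: filter_forall => m.
  have [Fm|//] := in_ultra_setVsetC (Km m) FU.
  by exfalso; apply: nFm; exists m.
apply: filterS (filterI FK FN) => x [[m [xm xr]] xN] /=.
have Nm : (N <= m)%N.
  by rewrite leqNgt; apply/negP => mN; apply: (xN (Ordinal mN)).
rewrite subr0; apply: le_lt_trans (fM x) _.
apply: (@le_lt_trans _ _ (M * m.+1%:R^-1)); first by rewrite ler_pM2l.
rewrite ltr_pdivrMr// mulrC -ltr_pdivrMr//.
by apply: lt_le_trans NM _; rewrite ler_nat.
Qed.

End positive_series.

(** * The converse: a gliding hump argument *)

Section gliding_hump.
Context {R : realType}.

Lemma sum_delta (c : R) i N : (i < N)%N -> \sum_(l < N) (l == i :> nat)%:R * c = c.
Proof.
move=> iN; rewrite (bigD1 (Ordinal iN))//= eqxx mul1r big1 ?addr0// => l.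
by rewrite -val_eqE /= => /negPf ->; rewrite mul0r.
Qed.

(** The pairwise hypothesis says that at most one term exceeds its bound
    [2^-l]. *)
Lemma sum_one_large (v : nat -> R) (B : R) N : 0 <= B ->
  (forall l, (l < N)%N -> v l <= B) ->
  (forall i l, (i < l < N)%N -> v i <= 2^-1 ^+ i \/ v l <= 2^-1 ^+ l) ->
  \sum_(l < N) v l <= 2 + B.
Proof.
move=> B0 vB small.
have [[i [iN vi]]|none] := pselect (exists i, (i < N)%N /\ 2^-1 ^+ i < v i); last first.
  apply: (@le_trans _ _ 2); last by rewrite lerDl.
  apply: le_trans (sum_halfX_le N); apply: ler_sum => l _.
  by rewrite leNgt; apply/negP => vl; apply: none; exists l.
apply: (@le_trans _ _ (\sum_(l < N) (2^-1 ^+ l + (l == i :> nat)%:R * B))).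
  apply: ler_sum => l _; have [->|li] := eqVneq (nat_of_ord l) i.
    by rewrite mul1r; apply: le_trans (vB _ iN) _; rewrite lerDr ltW ?halfX_gt0.
  rewrite mul0r addr0; have [il|il|il] := ltngtP i l.
  - have [|h|//] := small i l; first by rewrite il /=.
    by move: h; rewrite leNgt vi.
  - have [|//|h] := small l i; first by rewrite il /=.
    by move: h; rewrite leNgt vi.
  - by rewrite il eqxx in li.
by rewrite big_split/= sum_delta// lerD// sum_halfX_le.
Qed.

End gliding_hump.

Section converse.
Context (R : realType) (E : banachLatticeType R).
Local Notation p := abs_weak_seminorm.

Lemma abs_weakly_null_dual (u : nat -> E) (f : dual E) : abs_weakly_null u ->
  f (u n) @[n --> \oo] --> (0 : R).
Proof.
move=> /abs_weakly_null_seminorm/(_ f)/cvgrPdist_lt u0.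
apply/cvgrPdist_lt => e /u0; apply: filterS => n; rewrite !sub0r !normrN.
move=> /le_lt_trans; apply; rewrite [leRHS]ger0_norm ?abs_weak_seminorm_ge0//.
exact: dual_le_abs_weak_seminorm.
Qed.

(** With [g k = f k - phi] for a cluster point [phi] of the [f k], the sequence
    [g k] clusters at 0 pointwise, whereas each [g k] tends to 0 along the weakly
    null sequences [x] and [y]. Each new index [k] is therefore chosen so that
    [g k] is small on the earlier [y (j i)] and on the finitely many [x n] where an
    earlier [g (j i)] is still large, and so that [phi (y k)] is small. The humps
    of the [g (j l)] along [x] are then almost disjoint, and the matrix of the
    [g (j l) (y (j i))] is bounded below by almost the identity matrix; for the
    entries with [l < i] this follows from [0 <= f (j l) (y (j i))]. *)
Lemma almost_disjoint_selection (y x : nat -> E) (f : nat -> dual E) :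
  (forall n, vle 0 (y n)) -> weakly_null y ->
  (forall n, positive_dual (f n)) -> (forall n z, `|f n z| <= `|z|) ->
  (forall n, f n (y n) = 1) -> abs_weakly_null x ->
  exists (j : nat -> nat) (phi : dual E), [/\ forall z, `|phi z| <= `|z|,
    forall k, (k <= j k)%N,
    forall i l, (l == i)%:R - 2^-1 ^+ l / 4 <= f (j l) (y (j i)) - phi (y (j i)) &
    forall i l n, (i < l)%N -> `|f (j i) (x n) - phi (x n)| <= 2^-1 ^+ i \/
                               `|f (j l) (x n) - phi (x n)| <= 2^-1 ^+ l].
Proof.
move=> ypos y0 fpos fn fy xnull.
have [F [FU Foo]] := @ultraFilterLemma nat \oo _.
have [phi phin phiF] := dual_ultrafilter_limit FU fn.
pose g n z : R := f n z - phi z.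
have gx n : g n (x m) @[m --> \oo] --> (0 : R).
  rewrite -[X in _ --> X]subr0; apply: cvgB; exact: abs_weakly_null_dual.
pose Q (s : seq nat) k := [/\ (size s <= k)%N,
  `|phi (y k)| <= 2^-1 ^+ size s / 4 &
  forall i : 'I_(size s), `|g k (y (nth 0%N s i))| <= 2^-1 ^+ size s / 4 /\
    forall n, `|g (nth 0%N s i) (x n)| <= 2^-1 ^+ i \/
              `|g k (x n)| <= 2^-1 ^+ size s].
have [s|j jQ] := @history_choice _ Q.
  have h4 : 0 < 2^-1 ^+ size s / 4 :> R by rewrite divr_gt0// halfX_gt0.
  suff [k [[k1 k2] k3]] : exists k, ((size s <= k)%N /\
      `|phi (y k)| <= 2^-1 ^+ size s / 4) /\
      forall i : 'I_(size s), `|g k (y (nth 0%N s i))| <= 2^-1 ^+ size s / 4 /\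
      forall n, `|g (nth 0%N s i) (x n)| <= 2^-1 ^+ i \/
                `|g k (x n)| <= 2^-1 ^+ size s.
    by exists k.
  apply: (@filter_ex _ F); apply: filterI.
    apply: Foo; have /cvgrPdist_lt/(_ _ h4) yphi := y0 phi.
    apply: filterS (filterI (nbhs_infty_ge (size s)) yphi) => k [/= k1].
    by rewrite sub0r normrN => /ltW k2.
  apply: filter_forall => i; apply: filterI.
    by apply: filterS (phiF _ _ h4) => k; exact: ltW.
  have /cvgrPdist_lt/(_ _ (halfX_gt0 i))[N _ gN] := gx (nth 0%N s i).
  have : \forall k \near F, forall n : 'I_N, `|g k (x n)| < 2^-1 ^+ size s.
    by apply: filter_forall => n; apply: phiF; exact: halfX_gt0.
  apply: filterS => k gk n; have [Nn|nN] := leqP N n.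
    by left; have := gN n Nn; rewrite /= sub0r normrN => /ltW.
  by right; apply/ltW; exact: (gk (Ordinal nN)).
have jk k i : (i < k)%N -> `|g (j k) (y (j i))| <= 2^-1 ^+ k / 4 /\
    forall n, `|g (j i) (x n)| <= 2^-1 ^+ i \/ `|g (j k) (x n)| <= 2^-1 ^+ k.
  move=> ik; have [_ _] := jQ k; rewrite size_mkseq => /(_ (Ordinal ik)).
  by rewrite /= nth_mkseq.
have jphi k : `|phi (y (j k))| <= 2^-1 ^+ k / 4.
  by have [_ + _] := jQ k; rewrite size_mkseq.
exists j, phi; split => //.
- by move=> k; have [+ _ _] := jQ k; rewrite size_mkseq.
- move=> i l; have [li|il|->] := ltngtP l i.
  + (* Here only positivity of f (j l) is available, with phi (y (j i)) small. *)
  + rewrite sub0r lerBrDr -lerBrDl opprK.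
    have := jphi i; have := fpos (j l) _ (ypos (j i)).
    have : 2^-1 ^+ i <= 2^-1 ^+ l :> R.
      by apply: ler_wiXn2l; rewrite ?invr_ge0 ?invf_le1 ?ler1n// ltnW.
    by have := ler_norm (phi (y (j i))); lra.
  + have [+ _] := jk _ _ il; rewrite ler_norml => /andP[+ _].
    by rewrite sub0r.
  + by rewrite fy lerD2l lerN2; apply: le_trans (ler_norm _) (jphi i).
- by move=> i l n il; have [_ +] := jk _ _ il; exact.
Qed.

(** Let [G N] be the sum of the first [N] selected differences [f (j l) - phi].
    It is bounded on the range of [x], hence on its closed convex hull, uniformly
    in [N]. It is at least 1/2 on the [y (j i)] with [i < N], hence on their convex
    combinations. A convex combination of norm at most [(m+1)^-2], multiplied by
    [m+1], belongs to the amplified hull, and [G N] is at least [(m+1)/2] on it. *)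
Lemma amplified_hull_not_covered (y x : nat -> E) :
  (forall n, vle 0 (y n)) -> (forall n, `|y n| = 1) -> weakly_null y ->
  abs_weakly_null x -> ~ amplified_hull y `<=` closed_convex_hull (range x).
Proof.
move=> ypos y1 y0 xnull yx.
have /choice[f fP] n := positive_norming (ypos n).
have fpos n : positive_dual (f n) by have [] := fP n.
have fn n z : `|f n z| <= `|z| by have [_ + _] := fP n; exact.
have fy n : f n (y n) = 1 by have [_ _ ->] := fP n.
have [j [phi [phin jge jy jx]]] :=
  almost_disjoint_selection ypos y0 fpos fn fy xnull.
have [M xM] := abs_weakly_null_bounded xnull.
have M0 : 0 <= M by apply: le_trans (xM 0%N).
have /choice[G GE] N : exists G : dual E,
    forall z, G z = \sum_(l < N) (f (j l) z - phi z).
  apply: (@dual_of_bounded _ _ _ (\sum_(l < N) 2)) => [a u v|z].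
    rewrite scaler_sumr -big_split/=; apply: eq_bigr => l _.
    rewrite !dualD !dualZ -[_ *: (_ - _)]/(a * (f (j l) u - phi u)); ring.
  apply: le_trans (ler_norm_sum _ _ _) _; rewrite mulr_suml; apply: ler_sum => l _.
  by apply: le_trans (ler_normB _ _) _; rewrite mulr_natl mulr2n lerD.
have Gx N n : G N (x n) <= 2 + 2 * M.
  rewrite GE; apply: (@le_trans _ _ (\sum_(l < N) `|f (j l) (x n) - phi (x n)|)).
    by apply: ler_sum => l _; exact: ler_norm.
  apply: (sum_one_large (v := fun l => `|f (j l) (x n) - phi (x n)|)) => [|l _|i l /andP[il _]]; last exact: jx.
    by rewrite mulr_ge0.
  apply: le_trans (ler_normB _ _) _; rewrite mulr_natl mulr2n.
  by apply: lerD; apply: le_trans (xM n).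
have Gy N i : (i < N)%N -> 2^-1 <= G N (y (j i)).
  move=> iN; rewrite GE.
  apply: (@le_trans _ _ (\sum_(l < N) ((l == i :> nat)%:R * 1 - 2^-1 ^+ l / 4))).
    rewrite sumrB sum_delta// -mulr_suml; have := @sum_halfX_le R N; lra.
  by apply: ler_sum => l _; rewrite mulr1; exact: jy.
have yj0 : weakly_null (y \o j).
  move=> h; have /cvgrPdist_lt y0h := y0 h.
  apply/cvgrPdist_lt => e /y0h[N _ hN]; exists N => // n /= Nn.
  by apply: hN => /=; exact: leq_trans (jge n).
have [m mM] : exists m : nat, 2 * (2 + 2 * M) < m.+1%:R.
  by exists (Num.truncn (2 * (2 + 2 * M))); rewrite truncnS_gt.
have m0 : (0 : R) < m.+1%:R by [].
have d0 : (0 : R) < m.+1%:R^-1 * m.+1%:R^-1 by rewrite mulr_gt0// invr_gt0.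
have [s [s0 s1 sd]] := weakly_null_small_convex_comb yj0 d0.
pose t : seq (nat * R) := [seq (q.1, m.+1%:R * q.2) | q <- s].
have tE : comb (y \o j) t = m.+1%:R *: comb (y \o j) s.
  rewrite /comb big_map scaler_sumr; apply: eq_bigr => q _ /=.
  by rewrite scalerA.
have tK : amplified_hull y (comb (y \o j) t).
  exists m; split; last first.
    by rewrite tE normrZ gtr0_norm// -ler_pdivlMl.
  have -> : m.+1%:R = \sum_(q <- t) q.2 :> R.
    by rewrite big_map -mulr_sumr s1 mulr1.
  apply: series_hull_comb => q /mapP[r /s0 r0 ->] /=.
  by rewrite mulr_ge0.
pose N := (\max_(q <- s) q.1).+1.
have := dual_le_closed_convex_hull (h := G N) (c := 2 + 2 * M) _ (yx _ tK).
apply/not_implyP; split.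
  by move=> _ [n _ <-]; exact: Gx.
apply/negP; rewrite -ltNge tE dualZ.
have : 2^-1 <= G N (comb (y \o j) s).
  have -> : 2^-1 = \sum_(q <- s) 2^-1 * q.2 :> R by rewrite -mulr_sumr s1 mulr1.
  rewrite /comb linear_sum !big_seq.
  apply: ler_sum => q qs; rewrite dualZ mulrC ler_wpM2l ?s0//.
  apply: Gy; rewrite ltnS (big_rem _ qs) /=; exact: leq_maxl.
rewrite -(ler_pM2l m0) => /(lt_le_trans _); apply.
by lra.
Qed.

(** Passing to a subsequence with norms bounded below and normalizing keeps
    weak convergence to 0. *)
Lemma not_null_normalized_subsequence (u : nat -> E) :
  (forall n, vle 0 (u n)) -> weakly_null u ->
  ~ `|u n| @[n --> \oo] --> (0 : R) ->
  exists y : nat -> E, [/\ forall n, vle 0 (y n), forall n, `|y n| = 1 &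
    weakly_null y].
Proof.
move=> upos u0 un.
have [e e0 /choice[k kP]] : exists2 e : R, 0 < e &
    forall N, exists n, (N <= n)%N /\ e <= `|u n|.
  apply: contrapT => h; apply: un; apply/cvgrPdist_lt => e e0.
  apply: contrapT => h'; apply: h; exists e => // N.
  apply: contrapT => h''; apply: h'; exists N => // n /= Nn.
  rewrite sub0r normrN normr_id ltNge; apply/negP => en.
  by apply: h''; exists n.
have uk0 n : 0 < `|u (k n)| by have [_ /(lt_le_trans e0)] := kP n.
exists (fun n => `|u (k n)|^-1 *: u (k n)); split=> [n|n|f].
- by apply: vscale_ge0 => //; rewrite invr_ge0.
- by rewrite normrZ normfV normr_id mulVf// gt_eqF.
- have /cvgrPdist_lt uf := u0 f; apply/cvgrPdist_lt => d d0.
  have [|N _ uN] := uf (e * d); first by rewrite mulr_gt0.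
  exists N => // n /= Nn; have [nk ek] := kP n.
  have := uN (k n) (leq_trans Nn nk).
  rewrite /= !sub0r !normrN dualZ normrM normfV normr_id => h.
  by rewrite ltr_pdivrMl//; apply: lt_le_trans h _; rewrite ler_wpM2r// ltW.
Qed.

End converse.

Theorem theorem3p5 (R : realType) (E : banachLatticeType R) :
  positive_schur_property E <->
  forall A : set E, abs_weakly_compact A ->
    exists2 u : nat -> E, abs_weakly_null u &
      A `<=` closed_convex_hull (range u).
Proof.
split=> [|sub_hull u upos u0]; first exact: positive_schur_sub_hull.
apply: contrapT => /(not_null_normalized_subsequence upos u0)[y [ypos y1 y0]].
have ynull f : abs_weak_seminorm f (y n) @[n --> \oo] --> (0 : R).
  have -> : (fun n => abs_weak_seminorm f (y n)) = (fun n => dual_abs f (y n)).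
    by apply/funext => n; rewrite /abs_weak_seminorm vabs_ger0.
  exact: y0.
have [|x xnull] := sub_hull (amplified_hull y).
  by apply: amplified_hull_compact => // n; rewrite y1.
exact: amplified_hull_not_covered.
Qed.
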